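(* Every finite $AW^*$-algebra is clean. More precisely, let $T$ be an element of a finite $AW^*$-algebra $\mathcal{A}$. Then there exists an idempotent $P\in\mathcal{A}$ such that $T-P$ is invertible in $\mathcal{A}$ and $\|(T-P)^{-1}\|\leqslant 4$.
   Context: An $AW^*$-algebra is a $C^*$-algebra such that (A) in the partially ordered set of projections (self-adjoint idempotents), any set of orthogonal projections has a least upper bound; and (B) any maximal commutative self-adjoint subalgebra is generated by its projections. It has an identity $I$. Projections $E,F\in\mathcal{A}$ are equivalent, $E\sim F$, if there is a partial isometry $V\in\mathcal{A}$ with $V^*V=E$ and $VV^*=F$. A projection is finite if it is not equivalent to any proper subprojection of itself; $\mathcal{A}$ is finite if $I$ is finite. A ring is clean if every element is the sum of an invertible element and an idempotent. An idempotent is an element $P$ with $P^2=P$ (not necessarily self-adjoint). *)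

(* Defs.v *)
From HB Require Import structures.
From mathcomp Require Import all_boot all_order all_algebra.
From mathcomp Require Import all_classical all_reals all_analysis.
From mathcomp Require Import complex.

Set Implicit Arguments.
Unset Strict Implicit.
Unset Printing Implicit Defensive.

Import Order.TTheory GRing.Theory Num.Theory.
Import numFieldNormedType.Exports.

Local Open Scope classical_set_scope.
Local Open Scope ring_scope.
Local Open Scope complex_scope.

(** Unital complex C*-algebras; the zero algebra is allowed ([algType] would
    exclude it). The norm takes its values in [R[i]]; it is a nonnegative real
    there. The product is part of the mixin, and not inherited from
    [GRing.PzRing], because HB rejects a structure that joins [GRing.PzSemiRing]
    and [Num.SemiNormedZmodule] above [Num.NumDomain]; the ring structure is
    recovered as an instance right after. *)
HB.mixin Record isCStarAlgebra (R : realType) A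
    of CompleteNormedModule R[i] A := {
  cstar_one : A;
  cstar_mul : A -> A -> A;
  star : A -> A;
  cstar_mulA : associative cstar_mul;
  cstar_mul1r : left_id cstar_one cstar_mul;
  cstar_mulr1 : right_id cstar_one cstar_mul;
  cstar_mulDl : left_distributive cstar_mul +%R;
  cstar_mulDr : right_distributive cstar_mul +%R;
  cstar_scalerAl : forall (k : R[i]) (x y : A),
    k *: cstar_mul x y = cstar_mul (k *: x) y;
  cstar_scalerAr : forall (k : R[i]) (x y : A),
    k *: cstar_mul x y = cstar_mul x (k *: y);
  cstar_normM : forall x y : A, `|cstar_mul x y| <= `|x| * `|y|;
  starK : involutive star;
  starD : {morph star : x y / x + y};
  starZ : forall (k : R[i]) (x : A), star (k *: x) = k^* *: star x;
  starM : forall x y : A, star (cstar_mul x y) = cstar_mul (star y) (star x);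
  cstar_norm : forall x : A, `|cstar_mul (star x) x| = `|x| ^+ 2
}.

#[short(type="cstarAlgType")]
HB.structure Definition CStarAlgebra (R : realType) :=
  {A of CompleteNormedModule R[i] A & isCStarAlgebra R A}.

#[non_forgetful_inheritance]
HB.instance Definition _ (R : realType) (A : cstarAlgType R) :=
  GRing.Zmodule_isPzRing.Build (CStarAlgebra.sort A)
    (@cstar_mulA R A) (@cstar_mul1r R A) (@cstar_mulr1 R A)
    (@cstar_mulDl R A) (@cstar_mulDr R A).

Section Rings.
Context {A : pzRingType}.
Implicit Types x y e : A.

Definition is_idempotent e := e * e = e.

Definition is_inverse x y := x * y = 1 /\ y * x = 1.

Definition invertible x := exists y, is_inverse x y.

End Rings.

Definition clean_ring (A : pzRingType) :=
  forall x : A, exists u e : A, [/\ invertible u, is_idempotent e & x = u + e].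

Section AWStar.
Context {R : realType} {A : cstarAlgType R}.
Implicit Types (E F V : A) (S B M : set A).

Definition projection E := star E = E /\ is_idempotent E.

Definition proj_le E F := E * F = E.

Definition orthogonal_projections S :=
  (forall E, S E -> projection E) /\
  (forall E F, S E -> S F -> E <> F -> E * F = 0).

(** Least upper bound in the poset of projections: both the bound and its
    competitors range over projections only. *)
Definition proj_lub S F :=
  [/\ projection F,
      forall E, S E -> proj_le E F &
      forall G, projection G -> (forall E, S E -> proj_le E G) -> proj_le F G].

Definition subalgebra B :=
  [/\ B 0,
      forall x y, B x -> B y -> B (x + y),
      forall (k : R[i]) x, B x -> B (k *: x) &
      forall x y, B x -> B y -> B (x * y)].

Definition commutative_selfadjoint_subalgebra B :=
  [/\ subalgebra B,
      forall x, B x -> B (star x) &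
      forall x y, B x -> B y -> x * y = y * x].

Definition maximal_commutative_selfadjoint_subalgebra M :=
  commutative_selfadjoint_subalgebra M /\
  forall B, commutative_selfadjoint_subalgebra B -> M `<=` B -> B = M.

(** The smallest norm-closed subalgebra containing [S]. *)
Definition generated_subalgebra S : set A :=
  smallest [set B | closed B /\ subalgebra B] S.

Definition generated_by_projections B :=
  B = generated_subalgebra [set E | B E /\ projection E].

Definition partial_isometry V := projection (star V * V).

Definition proj_equiv E F :=
  exists V, [/\ partial_isometry V, star V * V = E & V * star V = F].

Definition finite_projection E :=
  projection E /\
  forall F, projection F -> proj_le F E -> proj_equiv E F -> F = E.

End AWStar.

Definition AWstar (R : realType) (A : cstarAlgType R) :=
  (forall S : set A, orthogonal_projections S -> exists F, proj_lub S F) /\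
  (forall M : set A, maximal_commutative_selfadjoint_subalgebra M ->
     generated_by_projections M).

Definition finite_AWstar (R : realType) (A : cstarAlgType R) :=
  AWstar A /\ finite_projection (1 : A).

(* Main.v *)
(** Let [E] be a spectral projection of [T^* T] on which [T] is small, [1 - E]
    being the part where [T] is bounded below, and let [1 - F] be the projection
    onto the range of [T (1 - E)]; then [1 - E ~ 1 - F], and [E ~ F] since the
    algebra is finite. If [P] is an idempotent with range [F] which maps [E]
    isomorphically onto [F], then [T - P] is block triangular from [E, 1 - E] to
    [F, 1 - F], so it is invertible. Such a [P] has as kernel a slight tilt of
    the range of [1 - E]. The inverse [F -> E] of its restriction to [E] may be
    nearly singular, but has norm at most [1 + 1/20], and only this enters the
    estimate of the inverse of [T - P].

    All the operator theory is reduced to [polar_cut]: up to a small error, an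
    element is a partial isometry times an invertible element of a corner.
    It rests on the density of the combinations of projections in a maximal
    commutative self-adjoint subalgebra, on square roots of elements near [1],
    and on the argument of Kelley and Vaught for the positivity of [x^* x].
    Cancellation of [~] in a finite algebra uses Zorn's lemma and Kaplansky's
    proof that equivalence is additive over orthogonal families between two
    orthogonal projections. *)
Require Import Defs.
From mathcomp Require Import all_boot all_order all_algebra.
From mathcomp Require Import all_classical all_reals all_analysis.
From mathcomp Require Import complex.
From mathcomp Require Import ring lra.
From Stdlib Require Ncring_tac.

Import Order.TTheory GRing.Theory Num.Theory.
Import numFieldNormedType.Exports.

Set Implicit Arguments.
Unset Strict Implicit.
Unset Printing Implicit Defensive.

Local Open Scope classical_set_scope.
Local Open Scope ring_scope.
Local Open Scope complex_scope.

Section CStar.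
Context {R : realType} {A : cstarAlgType R}.
Implicit Types (x y z e f p : A) (r t : R).

(** These two instances make [A] known to the noncommutative ring tactic behind [ncring]. Scalar
    multiplication and [star] are atoms for it, so they are moved out of the way by hand first. *)
#[local] Instance ring_ops :
  @Ncring.Ring_ops A 0 1 +%R *%R (fun x y => x - y) -%R eq := {}.

#[local] Instance ring_laws : Ncring.Ring (Ro := ring_ops).
Proof.
by split; rewrite /Algebra_syntax.equality /=;
  try exact: RelationClasses.eq_equivalence; try (by repeat move=> ? ? ->);
  [exact: add0r | exact: addrC | exact: addrA | exact: mul1r | exact: mulr1
  | exact: mulrA | exact: mulrDl | move=> x y z; exact: mulrDr | exact: subrr].
Qed.

Ltac ncring := Ncring_tac.non_commutative_ring.

(* [lra] and [nra] choke on hypotheses that are equations in [A]. *)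
Ltac clear_eqA :=
  repeat match goal with H : @eq ?T _ _ |- _ =>
    unify T (CStarAlgebra.sort A); clear H end.
Ltac rlra := clear_eqA; lra.
Ltac rnra := clear_eqA; nra.

(** * Norm and limits *)

(* The norm of [Defs] is [R[i]]-valued; estimates are done on its real part. *)
Definition nr x : R := complex.Re `|x|.

Lemma normE x : `|x| = (nr x)%:C.
Proof.
have := normr_ge0 x; rewrite lecE /nr.
by case: (`|x|) => a b /= /andP[/eqP -> _].
Qed.

Lemma nr_ge0 x : 0 <= nr x.
Proof. by have := normr_ge0 x; rewrite normE lecE /= => /andP[]. Qed.

Lemma nr0 : nr 0 = 0 :> R.
Proof. by rewrite /nr normr0. Qed.

Lemma nr_eq0 x : nr x = 0 -> x = 0.
Proof. by move=> h; apply/eqP; rewrite -normr_eq0 normE h. Qed.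

Lemma nrN x : nr (- x) = nr x.
Proof. by rewrite /nr normrN. Qed.

Lemma nrBC x y : nr (x - y) = nr (y - x).
Proof. by rewrite /nr distrC. Qed.

Lemma nrD x y : nr (x + y) <= nr x + nr y.
Proof. by rewrite -lecR rmorphD /= -!normE ler_normD. Qed.

Lemma nrB x y : nr (x - y) <= nr x + nr y.
Proof. by rewrite -(nrN y) nrD. Qed.

Lemma nrM x y : nr (x * y) <= nr x * nr y.
Proof. by rewrite -lecR rmorphM /= -!normE; exact: cstar_normM. Qed.

Lemma nrM_le x y r t : nr x <= r -> nr y <= t -> nr (x * y) <= r * t.
Proof.
move=> hx hy; apply: le_trans (nrM _ _) _.
by apply: ler_pM => //; exact: nr_ge0.
Qed.

Lemma nrZ (k : R[i]) x : nr (k *: x) = complex.Re `|k| * nr x.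
Proof. by rewrite /nr normrZ (normE x) normc_def -rmorphM. Qed.

Lemma nrZr r x : nr (r%:C *: x) = `|r| * nr x.
Proof. by rewrite nrZ normc_def /= expr0n addr0 sqrtr_sqr. Qed.

Lemma scalAl (k : R[i]) x y : (k *: x) * y = k *: (x * y).
Proof. by rewrite (cstar_scalerAl k x y). Qed.

Lemma scalAr (k : R[i]) x y : x * (k *: y) = k *: (x * y).
Proof. by rewrite (cstar_scalerAr k x y). Qed.

Lemma star_mul x y : star (x * y) = star y * star x.
Proof. exact: starM. Qed.

Lemma star1 : star 1 = 1 :> A.
Proof. by rewrite -[LHS]mulr1 -{2}(starK 1) -star_mul mulr1 starK. Qed.

Lemma star0 : star 0 = 0 :> A.
Proof. by apply: (addrI (star 0)); rewrite -starD !addr0. Qed.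

Lemma starN x : star (- x) = - star x.
Proof. by apply: (addrI (star x)); rewrite -starD !subrr star0. Qed.

Lemma starB x y : star (x - y) = star x - star y.
Proof. by rewrite starD starN. Qed.

Lemma starZr r x : star (r%:C *: x) = r%:C *: star x.
Proof. rewrite starZ; congr (_ *: _); exact: conjc_real. Qed.

Lemma nr_starM x : nr (star x * x) = nr x ^+ 2.
Proof.
apply: (@complexI R); rewrite rmorphXn /= -!normE; exact: cstar_norm.
Qed.

(** The C*-identity gives |y|^2 = |y^* y| <= |y^*| |y|; divide by |y| and apply this to both [x] and
    [star x]. *)
Lemma nr_star x : nr (star x) = nr x.
Proof.
suff H y : nr y <= nr (star y) by apply/eqP; rewrite eq_le H andbT -{2}(starK x) H.
have [->|y0] := eqVneq (nr y) 0; first exact: nr_ge0.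
have yp : 0 < nr y by rewrite lt_def y0 nr_ge0.
by rewrite -(ler_pM2r yp) -expr2 -nr_starM nrM.
Qed.

Lemma nr_starMr x : nr (x * star x) = nr x ^+ 2.
Proof. by rewrite -{1}(starK x) nr_starM nr_star. Qed.

Lemma nr_sqr x : star x = x -> nr (x * x) = nr x ^+ 2.
Proof. by move=> h; rewrite -nr_starM h. Qed.

Lemma nr_le_sqr x r : 0 <= r -> nr (star x * x) <= r ^+ 2 -> nr x <= r.
Proof. by move=> r0; rewrite nr_starM ler_pXn2r // nnegrE ?nr_ge0. Qed.

Lemma projection1 : projection (1 : A).
Proof. by split; rewrite ?star1 //; exact: mulr1. Qed.

Lemma nr_proj p : projection p -> nr p <= 1.
Proof.
move=> [s i]; have := nr_sqr s; rewrite i => h.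
have := nr_ge0 p; move: h {s i} => h p0.
by rewrite leNgt; apply/negP => h1; nra.
Qed.

Lemma nr1 : nr (1 : A) <= 1.
Proof. exact: nr_proj projection1. Qed.

Lemma nr_piso v : projection (star v * v) -> nr v <= 1.
Proof. by move=> h; apply: nr_le_sqr => //; rewrite expr1n nr_proj. Qed.

Lemma eps_eq x y : (forall d : R, 0 < d -> nr (x - y) <= d) -> x = y.
Proof.
move=> h; apply/eqP; rewrite -subr_eq0; apply/eqP/nr_eq0/eqP.
rewrite eq_le nr_ge0 andbT; apply/ler_addgt0Pl => d d0.
by rewrite addr0 h.
Qed.

(** * Limits of sequences and fixed points *)

Definition tends_to (u : nat -> A) x :=
  forall d : R, 0 < d -> exists N, forall n, (N <= n)%N -> nr (u n - x) <= d.

Lemma cauchy_tends_to (u : nat -> A) :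
  (forall d : R, 0 < d -> exists N, forall n, (N <= n)%N -> nr (u n - u N) <= d) ->
  exists x, tends_to u x.
Proof.
move=> hu.
have hc : cauchy (u @ \oo).
  apply: cauchy_exP => e e0.
  (* A positive element of [R[i]] is real, so half of its real part is a real radius below it. *)
  have [r r0 re] : exists2 r : R, 0 < r & r%:C < e.
    move: e0; case: e => a b; rewrite ltcE /= => /andP[/eqP -> a0].
    by exists (a / 2); rewrite ?divr_gt0 // ltcE /= eqxx /=; lra.
  have [N hN] := hu r r0; exists (u N); exists N => // n /= Nn.
  rewrite -ball_normE /= normE; apply: le_lt_trans re.
  by rewrite lecR nrBC hN.
have [x hx] : exists x, u @ \oo --> x.
  by exists (lim (u @ \oo)); exact: cauchy_cvg hc.
exists x => d d0; move: (hx) => {}hx.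
have dC : 0 < d%:C by rewrite ltcR.
have [N _ hN] := hx _ (nbhsx_ballx x _ dC); exists N => n Nn.
have := hN n Nn; rewrite -ball_normE /= normE ltcR nrBC; exact: ltW.
Qed.

Lemma geometric_tends_to (u : nat -> A) (q c : R) : 0 <= q < 1 ->
  (forall n, nr (u n.+1 - u n) <= c * q ^+ n) -> exists x, tends_to u x.
Proof.
move=> /andP[q0 q1] hu; apply: cauchy_tends_to => d d0.
have c0 : 0 <= c by have := hu 0%N; rewrite expr0 mulr1; apply: le_trans; exact: nr_ge0.
(* The exact value of the finite geometric sum is kept, so that the induction closes with an
   equality. *)
have b n k : nr (u (n + k)%N - u n) <= c * q ^+ n / (1 - q) * (1 - q ^+ k).
  elim: k => [|k IH]; first by rewrite addn0 subrr nr0 expr0 subrr mulr0.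
  have -> : u (n + k.+1)%N - u n = (u (n + k).+1 - u (n + k)%N) + (u (n + k)%N - u n).
    by rewrite addnS; ncring.
  apply: le_trans (nrD _ _) _; apply: le_trans (lerD (hu _) IH) _.
  rewrite exprD exprS le_eqVlt; apply/orP; left; apply/eqP; field; lra.
have [N hN] : exists N, c * q ^+ N / (1 - q) <= d.
  have := @cvg_expr R q; rewrite ger0_norm // => /(_ q1) /cvgrPdist_le.
  have e0 : 0 < d * (1 - q) / (c + 1) by rewrite divr_gt0 ?mulr_gt0; lra.
  move=> /(_ _ e0) [N _ /(_ N (leqnn _))] /=.
  rewrite sub0r normrN ger0_norm ?exprn_ge0 // ler_pdivlMr; last lra.
  move=> h; exists N; rewrite ler_pdivrMr; last lra.
  by have : 0 <= q ^+ N := exprn_ge0 _ q0; nra.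
exists N => n Nn; rewrite -(subnKC Nn); apply: le_trans (b _ _) _.
apply: le_trans hN; rewrite ler_piMr //.
  by rewrite mulr_ge0 ?mulr_ge0 ?exprn_ge0 // invr_ge0; lra.
by rewrite lerBlDr lerDl exprn_ge0.
Qed.

Lemma tends_to_le (u : nat -> A) x r :
  tends_to u x -> (forall n, nr (u n) <= r) -> nr x <= r.
Proof.
move=> hu hr; apply/ler_addgt0Pr => d d0; have [N hN] := hu d d0.
have -> : x = u N - (u N - x) by ncring.
by apply: le_trans (nrB _ _) _; apply: lerD => //; exact: hN.
Qed.

Lemma tends_to_comm (u : nat -> A) x y :
  tends_to u x -> (forall n, y * u n = u n * y) -> y * x = x * y.
Proof.
move=> hu hc; apply: eps_eq => d d0.
have e0 : 0 < d / (2 * nr y + 1) by rewrite divr_gt0 //; have := nr_ge0 y; lra.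
have [N /(_ N (leqnn _)) hN] := hu _ e0.
have -> : y * x - x * y = (u N - x) * y - y * (u N - x).
  by apply: subr0_eq; rewrite !(mulrDl, mulrDr) hc; ncring.
move: hN; rewrite ler_pdivlMr; last by have := nr_ge0 y; lra.
have := nrB ((u N - x) * y) (y * (u N - x)).
have := nrM (u N - x) y; have := nrM y (u N - x).
have := nr_ge0 y; have := nr_ge0 (u N - x); nra.
Qed.

Lemma tends_to_star (u : nat -> A) x :
  tends_to u x -> (forall n, star (u n) = u n) -> star x = x.
Proof.
move=> hu hs; apply: eps_eq => d d0.
have [N /(_ N (leqnn _)) hN] := hu _ (divr_gt0 d0 (ltr0Sn _ 1)).
have -> : star x - x = (u N - x) - star (u N - x) by rewrite starB hs; ncring.
have := nrB (u N - x) (star (u N - x)); rewrite nr_star; lra.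
Qed.

(** The Lipschitz bound is asked only between the terms of the sequence and its limit: the iteration
    for square roots satisfies it only for commuting elements of a ball. *)
Lemma tends_to_fix (u : nat -> A) x (g : A -> A) (c : R) :
  tends_to u x -> (forall n, u n.+1 = g (u n)) ->
  (forall n, nr (g (u n) - g x) <= c * nr (u n - x)) -> g x = x.
Proof.
move=> hu hg hc; apply: eps_eq => d d0.
have e0 : 0 < d / (`|c| + 1) by rewrite divr_gt0 //; have := normr_ge0 c; lra.
have [N hN] := hu _ e0.
have := hN _ (leqnn _); have := hN _ (leqnSn _); rewrite hg.
have -> : g x - x = (g (u N) - x) - (g (u N) - g x) by ncring.
have := nrB (g (u N) - x) (g (u N) - g x); have := hc N.
have := ler_norm c; have := nr_ge0 (u N - x).
set a := nr (u N - x); set b := nr (g (u N) - x) => a0 cc h1 h2 h3 h4.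
have : `|c| * (d / (`|c| + 1)) + d / (`|c| + 1) = d.
  by field; have := normr_ge0 c; lra.
have := normr_ge0 c; nra.
Qed.

(** The partial sums of the geometric series satisfy [u n.+1 = 1 + z * u n]; the limit is a fixed
    point, and y = 1 + z y also yields the norm bound. The last clause lets the inverse be cut down
    to corners later. *)
Lemma neumann z : nr z < 1 -> exists y,
  [/\ (1 - z) * y = 1, y * (1 - z) = 1, nr y <= (1 - nr z)^-1
    & forall w : A, w * z = z * w -> w * y = y * w].
Proof.
move=> z1; pose u := fix u n := if n is n'.+1 then 1 + z * u n' else 0 : A.
have z01 : 0 <= nr z < 1 by rewrite nr_ge0.
have hu n : nr (u n.+1 - u n) <= 1 * nr z ^+ n.
  elim: n => [|n IH]; first by rewrite /= mulr0 addr0 subr0 expr0 mulr1 nr1.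
  have -> : u n.+2 - u n.+1 = z * (u n.+1 - u n) by rewrite /=; ncring.
  apply: le_trans (nrM _ _) _; rewrite exprS mulrCA.
  by apply: ler_wpM2l => //; exact: nr_ge0.
have [y hy] := geometric_tends_to z01 hu.
have cy (w : A) : w * z = z * w -> w * y = y * w.
  move=> wz; apply: tends_to_comm hy _; elim=> [|n IH]; first by rewrite /= mulr0 mul0r.
  by rewrite /= mulrDr mulrDl mulr1 mul1r mulrA wz -!mulrA IH.
have fy : 1 + z * y = y.
  apply: (@tends_to_fix u y (fun y => 1 + z * y) (nr z)) => // n.
  have -> : 1 + z * u n - (1 + z * y) = z * (u n - y) by ncring.
  exact: nrM.
have r1 : (1 - z) * y = 1 by apply: subr0_eq; rewrite -[X in _ - X](addrK (z * y)) fy; ncring.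
exists y; split=> //; first by rewrite mulrBr mulr1 -(cy z) // -r1; ncring.
have p : 0 < 1 - nr z by lra.
rewrite -div1r ler_pdivlMr //; have := nrD 1 (z * y); rewrite fy.
have := nrM z y; have := nr1; nra.
Qed.

(** * Square roots and positivity *)

Lemma starZi x : star ('i%C *: x) = - ('i%C *: star x).
Proof. rewrite starZ -scaleNr; congr (_ *: _); by rewrite -[LHS]/(conjc _) /= /conjc /=; congr Complex; rewrite ?oppr0. Qed.

Lemma scalrA r t x : r%:C *: (t%:C *: x) = (r * t)%:C *: x.
Proof. by rewrite scalerA -rmorphM. Qed.

Lemma scaliA x : 'i%C *: ('i%C *: x) = - x.
Proof. by rewrite scalerA -[X in X *: _]/('i%C ^+ 2) sqr_i scaleN1r. Qed.

Lemma scalr2 x : (2 : R)%:C *: x = x + x.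
Proof. by rewrite (rmorph_nat (real_complex R) 2) scaler_nat. Qed.

(** With z = 1 - h and c = 1 - y, the equation c^2 = h becomes y = (z + y^2) / 2. Iteration from 0
    stays in the ball of radius |z| and among elements commuting with all that commutes with z;
    there g x - g y = (x + y)(x - y) / 2 contracts by the factor |z|. *)
Lemma sqrt_of_near1 h : star h = h -> nr (1 - h) < 1 -> exists c,
  [/\ star c = c, c * c = h & forall w : A, w * h = h * w -> w * c = c * w].
Proof.
move=> sh; set z := 1 - h => z1.
pose g y : A := 2^-1%:C *: (z + y * y).
pose u n := iter n g 0.
have z0 := nr_ge0 z.
have ub n : nr (u n) <= nr z.
  elim: n => [|n IH]; first by rewrite /= nr0.
  rewrite /= nrZr ger0_norm ?invr_ge0 //.
  have := nrD z (u n * u n); have := nrM (u n) (u n); have := nr_ge0 (u n).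
  rewrite -/(u n); nra.
have dg x y : nr x <= nr z -> nr y <= nr z -> x * y = y * x ->
    nr (g x - g y) <= nr z * nr (x - y).
  move=> hx hy xy.
  have -> : g x - g y = 2^-1%:C *: ((x + y) * (x - y)).
    rewrite /g -scalerBr; congr (_ *: _); rewrite !(mulrDl, mulrDr) !mulrN xy; ncring.
  rewrite nrZr ger0_norm ?invr_ge0 //.
  have := nrM (x + y) (x - y); have := nrD x y; have := nr_ge0 (x - y); nra.
have zu n : forall w : A, w * z = z * w -> w * u n = u n * w.
  move=> w wz; elim: n => [|n IH]; first by rewrite /= mulr0 mul0r.
  by rewrite /= /g scalAr scalAl mulrDr mulrDl wz -/(u n) mulrA IH -!mulrA IH.
have hu n : nr (u n.+1 - u n) <= nr z * nr z ^+ n.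
  elim: n => [|n IH].
    rewrite expr0 mulr1 subr0 (le_trans (ub 1%N)) //.
  have uc : u n.+1 * u n = u n * u n.+1 by apply: (zu n); symmetry; exact: (zu n.+1).
  apply: le_trans (dg _ _ (ub n.+1) (ub n) uc) _.
  by rewrite exprS; apply: ler_wpM2l.
have z01 : 0 <= nr z < 1 by rewrite z0.
have [y hy] := geometric_tends_to z01 hu.
have cy (w : A) : w * z = z * w -> w * y = y * w.
  by move=> wz; apply: tends_to_comm hy _ => n; exact: zu.
have yb : nr y <= nr z by apply: tends_to_le hy ub.
have fy : g y = y.
  apply: (tends_to_fix (c := nr z) hy) => // n.
  by apply: dg => //; symmetry; apply: (zu); symmetry; exact: cy.
have sy : star y = y.
  apply: tends_to_star hy _; elim=> [|n IH]; first by rewrite /= star0.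
  by rewrite /= /g starZr starD star_mul IH /z starB star1 sh.
have yy : y * y = y + y - z.
  have -> : y + y = z + y * y.
    by rewrite -scalr2 -[X in _ *: X]fy /g scalrA divff ?pnatr_eq0 // scale1r.
  ncring.
exists (1 - y); split; first by rewrite starB star1 sy.
  by rewrite mulrBl mul1r mulrBr mulr1 yy /z; ncring.
move=> w wh; rewrite mulrBr mulrBl mulr1 mul1r cy //.
by rewrite /z mulrBr mulrBl wh; ncring.
Qed.

(* [c = sqrt (1 - a^2)] makes [c + i a] unitary, and [c] is its real part. *)
Lemma nr_1Bsqr a : star a = a -> nr a < 1 -> nr (1 - a * a) <= 1.
Proof.
move=> sa a1.
have h1 : nr (1 - (1 - a * a)) < 1.
  have -> : 1 - (1 - a * a) = a * a by ncring.
  by rewrite nr_sqr //; have := nr_ge0 a; nra.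
have s1 : star (1 - a * a) = 1 - a * a by rewrite starB star1 star_mul sa.
have [c [sc cc hc]] := sqrt_of_near1 s1 h1.
have ca : a * c = c * a by apply: hc; rewrite mulrBr mulrBl; ncring.
set b := 'i%C *: a.
have sb : star b = - b by rewrite /b starZi sa.
have bb : b * b = - (a * a).
  by rewrite /b scalAl scalAr scaliA.
have bc : b * c = c * b by rewrite /b scalAl scalAr ca.
have u1 : nr (c + b) <= 1.
  apply: nr_piso; have -> : star (c + b) * (c + b) = 1; last exact: projection1.
  by rewrite starD sc sb mulrDl !mulrDr cc mulNr mulNr bb bc; ncring.
have u2 : nr (c - b) <= 1.
  by rewrite -nr_star starB sc sb opprK.
have c1 : nr c <= 1.
  have -> : c = 2^-1%:C *: ((c + b) + (c - b)).
    have -> : (c + b) + (c - b) = c + c by ncring.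
    by rewrite -scalr2 scalrA mulVf ?pnatr_eq0 // scale1r.
  rewrite nrZr ger0_norm ?invr_ge0 //; have := nrD (c + b) (c - b); lra.
by rewrite -cc nr_sqr // expr_le1 ?nr_ge0.
Qed.

Lemma nr_Bsqr a (t : R) : star a = a -> nr a ^+ 2 <= t -> nr (t%:C *: (1 : A) - a * a) <= t.
Proof.
move=> sa at'; apply/ler_addgt0Pr => d d0.
(* The excess d / 2 makes the norm of [s^-1 a] strictly less than 1, as [nr_1Bsqr] requires. *)
set s := Num.sqrt (t + d / 2).
have t0 : 0 <= t by apply: le_trans at'; rewrite exprn_ge0 ?nr_ge0.
have ss : s ^+ 2 = t + d / 2 by rewrite sqr_sqrtr //; lra.
have s0 : 0 < s by rewrite sqrtr_gt0; lra.
have h : nr (s^-1%:C *: a) < 1.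
  rewrite nrZr ger0_norm ?invr_ge0 ?(ltW s0) // mulrC ltr_pdivrMr // mul1r.
  have := nr_ge0 a; nra.
have := nr_1Bsqr _ h; rewrite starZr sa => /(_ erefl).
rewrite scalAl scalAr scalrA => h1.
have -> : t%:C *: (1 : A) - a * a =
    (s ^+ 2)%:C *: (1 - (s^-1 * s^-1)%:C *: (a * a)) - (d / 2)%:C *: (1 : A).
  rewrite scalerBr scalrA ss; have -> : (t + d / 2) * (s^-1 * s^-1) = 1.
    by rewrite -ss; field; rewrite gt_eqF.
  by rewrite scale1r rmorphD scalerDl; ncring.
apply: le_trans (nrB _ _) _; rewrite !nrZr ss !ger0_norm; try lra.
by have := nr1; nra.
Qed.

(** Positivity without spectra: the inequality says that the spectrum lies in [0, 2t]. Closure under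
    sums is then the triangle inequality. *)
Definition pos h := star h = h /\ exists t, nr (t%:C *: (1 : A) - h) <= t.

Lemma posD h k : pos h -> pos k -> pos (h + k).
Proof.
move=> [sh [t ht]] [sk [r hr]]; split; first by rewrite starD sh sk.
exists (t + r); rewrite rmorphD scalerDl.
have -> : t%:C *: (1 : A) + r%:C *: (1 : A) - (h + k) = (t%:C *: (1 : A) - h) + (r%:C *: (1 : A) - k) by ncring.
by apply: le_trans (nrD _ _) _; apply: lerD.
Qed.

Lemma pos_sqr a : star a = a -> pos (a * a).
Proof.
move=> sa; split; first by rewrite star_mul sa.
by exists (nr a ^+ 2); apply: nr_Bsqr.
Qed.

Lemma pos_proj p : projection p -> pos p.
Proof. by move=> [sp pp]; rewrite -pp; apply: pos_sqr. Qed.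

(* [h] perturbed by a positive constant is a square, to which [nr_Bsqr] applies. *)
Lemma pos_nr h t : pos h -> nr h <= t -> nr (t%:C *: (1 : A) - h) <= t.
Proof.
move=> [sh [r hr]] ht; apply/ler_addgt0Pr => d d0.
have r0 : 0 <= r by apply: le_trans hr; exact: nr_ge0.
set e := d / 2; have e0 : 0 < e by rewrite divr_gt0.
(* Since 1 - h1 = (r - h) / (r + e), its norm is at most r / (r + e) < 1, and [h1] has a square
   root. *)
set h1 := (r + e)^-1%:C *: (h + e%:C *: (1 : A)).
have re : 0 < r + e by lra.
have sh1 : star h1 = h1 by rewrite /h1 starZr starD starZr star1 sh.
have h11 : nr (1 - h1) < 1.
  have -> : 1 - h1 = (r + e)^-1%:C *: (r%:C *: (1 : A) - h).
    have -> : r%:C *: (1 : A) - h = (r + e)%:C *: (1 : A) - (h + e%:C *: (1 : A)).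
      by rewrite rmorphD scalerDl; ncring.
    by rewrite scalerBr scalrA mulVf ?gt_eqF // scale1r.
  rewrite nrZr ger0_norm ?invr_ge0 ?(ltW re) // mulrC ltr_pdivrMr //; lra.
have [c [sc cc _]] := sqrt_of_near1 sh1 h11.
set s := Num.sqrt (r + e); have ss : s * s = r + e by rewrite -expr2 sqr_sqrtr ?ltW.
set a := s%:C *: c; have sa : star a = a by rewrite /a starZr sc.
have aa : a * a = h + e%:C *: (1 : A).
  by rewrite /a scalAl scalAr scalrA cc /h1 ss scalrA divff ?gt_eqF // scale1r.
have : nr a ^+ 2 <= t + e.
  rewrite -nr_sqr // aa; apply: le_trans (nrD _ _) _; apply: lerD => //.
  by rewrite nrZr ger0_norm ?(ltW e0) // ler_piMr ?(ltW e0) // nr1.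
move=> /(nr_Bsqr sa); rewrite aa rmorphD scalerDl.
have -> : t%:C *: (1 : A) + e%:C *: (1 : A) - (h + e%:C *: (1 : A)) = t%:C *: (1 : A) - h by ncring.
by move=> /le_trans; apply; rewrite /e; lra.
Qed.

(** With t = |h| both t + h and t - h have norm at most t, while the difference of their squares is
    4 t h; hence 4 t^2 <= 2 t^2. *)
Lemma pos_anti h : pos h -> pos (- h) -> h = 0.
Proof.
move=> p n; apply: nr_eq0; set t := nr h.
have := pos_nr p (lexx _); have := pos_nr n; rewrite nrN => /(_ _ (lexx _)).
rewrite -/t opprK; set u := t%:C *: (1 : A) => h1 h2.
have t0 : 0 <= t by exact: nr_ge0.
have : 4 * t * t <= 2 * (t * t).
  have -> : 4 * t * t = nr ((u + h) * (u + h) - (u - h) * (u - h)).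
    have -> : (u + h) * (u + h) - (u - h) * (u - h) = (4 * t)%:C *: h.
      have uh : u * h = t%:C *: h by rewrite /u scalAl mul1r.
      have hu : h * u = t%:C *: h by rewrite /u scalAr mulr1.
      rewrite !(mulrDl, mulrDr, mulrN, mulNr) uh hu.
      by rewrite !mul1r !rmorphD !scalerDl; ncring.
    by rewrite nrZr ger0_norm //; lra.
  apply: le_trans (nrB _ _) _; have := nrM_le h1 h1; have := nrM_le h2 h2; lra.
by nra.
Qed.

(* Kelley and Vaught: [- y^*y] and hence [- yy^*] are projections, but
   [2 (yy^* + y^*y)] is a sum of two squares of self-adjoint elements. *)
Lemma star_mul_neq_opp_proj y p : projection p -> star y * y = - p -> y = 0.
Proof.
move=> hp yy; have [sp pp] := hp.
have yp : y * p = y.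
  apply/eqP; rewrite -subr_eq0; apply/eqP/nr_eq0.
  have : nr (y * p - y) ^+ 2 = 0.
    rewrite -nr_starM starB star_mul sp.
    have -> : (p * star y - star y) * (y * p - y) =
       p * (star y * y) * p - p * (star y * y) - (star y * y) * p + star y * y by ncring.
    rewrite yy; have -> : p * - p * p - p * - p - - p * p + - p = - (p * p * p) + p * p + p * p - p by ncring.
    rewrite !pp; have -> : - p + p + p - p = 0 :> A by ncring.
    exact: nr0.
  by move=> /eqP; rewrite sqrf_eq0 => /eqP.
set q := - (y * star y).
have hq : projection q.
  split; first by rewrite /q starN star_mul starK.
  rewrite /is_idempotent /q mulrN mulNr opprK mulrA -(mulrA y) yy mulrN yp mulNr.
  ncring.
set w1 := y + star y; set w2 := 'i%C *: (y - star y).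
have sw1 : star w1 = w1 by rewrite /w1 starD starK addrC.
have sw2 : star w2 = w2 by rewrite /w2 starZi starB starK -scalerN opprB.
have ww : w1 * w1 + w2 * w2 = - (p + p + (q + q)).
  rewrite /w2 scalAl scalAr scaliA /w1 /q.
  have -> : (y + star y) * (y + star y) - (y - star y) * (y - star y) =
    y * star y + y * star y + (star y * y + star y * y) by ncring.
  by rewrite yy; ncring.
have P := pos_proj hp; have Q := pos_proj hq.
have P1 := pos_sqr sw1; have P2 := pos_sqr sw2.
have PQ := posD (posD P P) (posD Q Q).
(* The negative of w1^2 is w2^2 + 2 p + 2 q, a sum of positive elements, so [pos_anti] applies; the
   same holds with the roles of [w1] and [w2] exchanged. *)
have w10 : w1 = 0.
  apply: nr_eq0; have : w1 * w1 = 0.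
    apply: pos_anti => //; have -> : - (w1 * w1) = w2 * w2 + (p + p + (q + q)).
      have -> : p + p + (q + q) = - - (p + p + (q + q)) by ncring.
      by rewrite -ww; ncring.
    exact: posD.
  move=> /(congr1 nr); rewrite nr_sqr // nr0 => /eqP; by rewrite sqrf_eq0 => /eqP.
have w20 : w2 = 0.
  apply: nr_eq0; have : w2 * w2 = 0.
    apply: pos_anti => //; have -> : - (w2 * w2) = w1 * w1 + (p + p + (q + q)).
      have -> : p + p + (q + q) = - - (p + p + (q + q)) by ncring.
      by rewrite -ww; ncring.
    exact: posD.
  move=> /(congr1 nr); rewrite nr_sqr // nr0 => /eqP; by rewrite sqrf_eq0 => /eqP.
have yN : star y = - y by apply/eqP; rewrite -addr_eq0 addrC; exact/eqP.
have : (2 : R)%:C *: y = 0.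
  move: w20; rewrite /w2 yN opprK -scalr2 => /(congr1 (fun x => 'i%C *: x)).
  by rewrite scaler0 scalerA -expr2 sqr_i scaleN1r => /eqP; rewrite oppr_eq0 => /eqP.
move=> /eqP; rewrite scaler_eq0 => /orP[|/eqP //].
by rewrite (rmorph_nat (real_complex R) 2) pnatr_eq0.
Qed.

(** The norm hypothesis says that [h] is at least [m] on the corner of [p]. Completed by l (1 - p)
    and divided by l, it is close to 1; if [c] is the square root and [y] the inverse of the result,
    then c y p / sqrt l is the inverse square root of [h] in the corner. *)
Lemma corner_inv_sqrt p h (l m : R) : projection p -> star h = h -> h * p = h ->
  0 < m <= l -> nr (l%:C *: p - h) <= l - m -> exists k,
  [/\ star k = k, k * p = k, forall w : A, w * p = p * w -> w * h = h * w -> w * k = k * w,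
      k * h * k = p & nr k ^+ 2 <= m^-1].
Proof.
move=> [sp pp] sh hp /andP[m0 ml] hl.
have l0 : 0 < l by lra.
have ph : p * h = h by rewrite -[in RHS]sh -[in RHS]hp star_mul sp sh.
set h1 := h + l%:C *: (1 - p).
set h2 := l^-1%:C *: h1.
have lh2 : l%:C *: h2 = h1 by rewrite scalrA divff ?gt_eqF // scale1r.
have sh2 : star h2 = h2 by rewrite /h2 /h1 !(starZr, starD) starN star1 sp sh.
have n2 : nr (1 - h2) <= 1 - m / l.
  have -> : 1 - h2 = l^-1%:C *: (l%:C *: p - h).
    have -> : l%:C *: p - h = l%:C *: (1 : A) - h1 by rewrite /h1 scalerBr; ncring.
    by rewrite scalerBr scalrA mulVf ?gt_eqF // scale1r.
  rewrite nrZr ger0_norm ?invr_ge0 ?(ltW l0) // mulrC ler_pdivrMr //.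
  by apply: le_trans hl _; rewrite mulrBl mul1r divfK ?gt_eqF.
have ml1 : 0 < m / l by rewrite divr_gt0.
have n2' : nr (1 - h2) < 1 by lra.
have [c [sc cc hc]] := sqrt_of_near1 sh2 n2'.
have [y [y1 y2 yn hy]] := neumann n2'.
have e2 : 1 - (1 - h2) = h2 by ncring.
rewrite e2 in y1 y2.
have hy' (w : A) : w * h2 = h2 * w -> w * y = y * w.
  by move=> e; apply: hy; rewrite mulrBr mulrBl e mulr1 mul1r.
have h2p : h2 * p = p * h2.
  by rewrite /h2 /h1 scalAl scalAr mulrDl mulrDr hp ph scalAl scalAr mulrBl mulrBr mul1r mulr1.
have h2pE : l%:C *: (h2 * p) = h.
  rewrite -scalAl lh2 /h1 mulrDl hp scalAl mulrBl mul1r pp subrr scaler0 addr0 //.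
have sy : star y = y.
  rewrite -[LHS]mulr1 -y1 mulrA -{1}sh2 -star_mul y1 star1 mul1r //.
have cp : c * p = p * c by symmetry; apply: hc; rewrite h2p.
have yp : y * p = p * y by symmetry; apply: hy'; rewrite h2p.
have cy : c * y = y * c by apply: hy'; symmetry; apply: hc.
set s := Num.sqrt l^-1; have ss : s * s = l^-1.
  by rewrite -expr2 sqr_sqrtr // invr_ge0 ltW.
have s0 : 0 <= s by exact: sqrtr_ge0.
set k0 := c * y * p.
have sk0 : star k0 = k0 by rewrite /k0 !star_mul sp sy sc cy mulrA -yp -mulrA -cp mulrA.
have hc0 (w : A) : w * p = p * w -> w * h = h * w -> w * k0 = k0 * w.
  move=> wp wh; have wh2 : w * h2 = h2 * w.
    rewrite /h2 /h1 scalAl scalAr mulrDl mulrDr wh scalAl scalAr.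
    by rewrite mulrBl mulrBr mul1r mulr1 wp.
  by rewrite /k0 !mulrA (hc w) // -(mulrA c) (hy' w) // -!mulrA wp.
have k0k0 : k0 * k0 = y * p.
  have pk0 : p * k0 = k0 by rewrite hc0 ?ph ?hp // /k0 -mulrA pp.
  rewrite {1}/k0 -(mulrA (c * y)) pk0 cy /k0 -!mulrA (mulrA c c) cc.
  by rewrite (mulrA h2) y1 mul1r.
have hk0 : h * k0 = k0 * h by apply: hc0; rewrite ?hp ?ph.
have k0p : k0 * p = k0 by rewrite /k0 -mulrA pp.
exists (s%:C *: k0); split.
- by rewrite starZr sk0.
- by rewrite scalAl k0p.
- by move=> w wp wh; rewrite scalAl scalAr hc0.
- rewrite scalAr !scalAl scalrA ss -mulrA hk0 mulrA k0k0 -mulrA ph -h2pE.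
  by rewrite scalAr scalrA mulVf ?gt_eqF // scale1r mulrA y2 mul1r.
- rewrite -nr_sqr ?starZr ?sk0 // scalAr scalAl scalrA ss k0k0 nrZr.
  rewrite ger0_norm ?invr_ge0 ?(ltW l0) //.
  have yb : nr (y * p) <= l / m.
    apply: le_trans (nrM _ _) _; apply: le_trans (_ : nr y <= _).
      by rewrite ler_piMr ?nr_ge0 // nr_proj.
    apply: le_trans yn _; rewrite -invf_div lef_pV2 ?posrE //; rlra.
  by apply: le_trans (ler_wpM2l _ yb) _; rewrite ?invr_ge0 ?(ltW l0) // mulrA mulVf ?gt_eqF // mul1r.
Qed.

(** * Approximation by combinations of projections *)

Definition commutant (S : set A) : set A :=
  [set x | forall y, S y -> x * y = y * x].

(** Since S is commutative it lies in its commutant S', so S'' lies in S' as well; elements of S''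
    therefore commute with each other. *)
Lemma bicommutant_csa (S : set A) :
  (forall x, S x -> S (star x)) -> (forall x y, S x -> S y -> x * y = y * x) ->
  commutative_selfadjoint_subalgebra (commutant (commutant S)).
Proof.
move=> Ss Sc; split; [split|..].
- by move=> y _; rewrite mul0r mulr0.
- by move=> x y hx hy z hz; rewrite mulrDl mulrDr hx // hy.
- by move=> k x hx z hz; rewrite scalAl scalAr hx.
- by move=> x y hx hy z hz; rewrite -mulrA hy // mulrA hx // mulrA.
- move=> x hx y hy; rewrite -(starK y) -!star_mul hx // => z hz.
  by rewrite -(starK z) -!star_mul hy //; exact: Ss.
- move=> x y hx hy; apply: hx => z hz; apply: hy => w hw; exact: Sc.
Qed.

Lemma masa_exists h : star h = h ->
  exists2 M : set A, maximal_commutative_selfadjoint_subalgebra M & M h.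
Proof.
move=> sh.
(* Zorn's lemma is applied to mere sets rather than subalgebras, and [h] is only required to commute
   with them: the property then passes to unions of chains, even the empty one. A maximal set [M]
   equals the bicommutant of [M] together with [h], so it is a subalgebra containing [h]. *)
pose P (X : set A) := [/\ forall x, X x -> X (star x),
  forall x y, X x -> X y -> x * y = y * x & forall x, X x -> x * h = h * x].
have [] := @Zorn_bigcup A P.
  move=> F FP tF; split.
  - by move=> x [X FX Xx]; exists X => //; have [H _ _] := FP _ FX; exact: H.
  - move=> x y [X FX Xx] [Y FY Yy].
    have [XY|YX] := tF _ _ FX FY.
      by have [_ H _] := FP _ FY; apply: H => //; exact: XY.
    by have [_ H _] := FP _ FX; apply: H => //; exact: YX.
  - by move=> x [X FX Xx]; have [_ _ H] := FP _ FX; exact: H.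
move=> M [[Ms Mc Mh] Mmax].
have maxE B : P B -> M `<=` B -> B = M.
  move=> PB MB; apply/seteqP; split=> //.
  by have := Mmax B; rewrite /proper; case: (pselect (B `<=` M)) => // nB H; case: H.
pose S : set A := [set x | M x \/ x = h].
have Ss x : S x -> S (star x) by case=> [/Ms|->]; [left|right].
have Sc x y : S x -> S y -> x * y = y * x.
  by case=> [Mx|->] [My|->] //; [exact: Mc | exact: Mh | symmetry; exact: Mh].
have SB : S `<=` commutant (commutant S) by move=> x Sx y hy; symmetry; exact: hy.
have csa := bicommutant_csa Ss Sc.
have PB : P (commutant (commutant S)).
  have [_ H1 H2] := csa; split=> // x hx; apply: H2 => //; apply: SB; by right.
have eM : commutant (commutant S) = M.
  by apply: maxE => // x Mx; apply: SB; left.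
exists M; last by rewrite -eM; apply: SB; right.
split; first by rewrite -eM.
move=> B [[B0 BD BZ BM] Bs Bc] MB; apply: maxE => //; split=> // x Bx.
by apply: Bc => //; apply: MB; rewrite -eM; apply: SB; right.
Qed.

Lemma masa_bicommutant M : maximal_commutative_selfadjoint_subalgebra M ->
  commutant (commutant M) = M.
Proof.
move=> [[_ Ms Mc] Mmax]; apply: Mmax; first exact: bicommutant_csa.
by move=> x Mx y hy; symmetry; exact: hy.
Qed.

(** Members may be zero, as happens in a common refinement; hence the guards [p i != 0] on
    coefficients later. *)
Definition partition_of_unity (I : finType) (p : I -> A) :=
  [/\ forall i, projection (p i), forall i j, i != j -> p i * p j = 0 & \sum_i p i = 1].

(** * Calculus of linear combinations over a partition of unity *)

Section Partition.
Variables (I : finType) (p : I -> A).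
Hypothesis pu : partition_of_unity p.

Definition comb (c : I -> R[i]) : A := \sum_i c i *: p i.

Lemma partition_mul i j : p i * p j = if i == j then p i else 0.
Proof.
have [P O _] := pu; case: eqP => [->|/eqP]; last exact: O.
by have [_ ->] := P j.
Qed.

Lemma combM (c d : I -> R[i]) : comb c * comb d = comb (fun i => c i * d i).
Proof.
rewrite /comb mulr_suml; apply: eq_bigr => i _; rewrite mulr_sumr.
rewrite (bigD1 i) //= big1 ?addr0 => [|j ij]; rewrite scalAl scalAr partition_mul.
  by rewrite eqxx scalerA.
by rewrite eq_sym (negbTE ij) !scaler0.
Qed.

Lemma comb1 : comb (fun=> 1) = 1.
Proof.
by have [_ _ <-] := pu; rewrite /comb; apply: eq_bigr => i _; rewrite scale1r.
Qed.

Lemma comb_mul i (c : I -> R[i]) : comb c * p i = c i *: p i.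
Proof.
rewrite /comb mulr_suml (bigD1 i) //= big1 ?addr0 => [|j ij].
  by rewrite scalAl partition_mul eqxx.
by rewrite scalAl partition_mul (negbTE ij) scaler0.
Qed.

Lemma combB (c d : I -> R[i]) : comb c - comb d = comb (fun i => c i - d i).
Proof.
by rewrite /comb -sumrB; apply: eq_bigr => i _; rewrite scalerBl.
Qed.

Lemma star_comb (c : I -> R) : star (comb (fun i => (c i)%:C)) = comb (fun i => (c i)%:C).
Proof.
rewrite /comb (big_morph star starD star0); apply: eq_bigr => i _.
by have [P _ _] := pu; rewrite starZr; have [-> _] := P i.
Qed.

(** The element is a convex combination of 1 and the symmetry 1 - 2 q, which is unitary. *)
Lemma nr_contract (q : A) (c : R) : projection q -> `|c| <= 1 -> nr (1 - q + c%:C *: q) <= 1.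
Proof.
move=> [sq qq] c1.
have u1 : nr (1 - (q + q)) <= 1.
  apply: nr_piso; have -> : star (1 - (q + q)) * (1 - (q + q)) = 1; last exact: projection1.
  rewrite starB starD star1 sq.
  have -> : (1 - (q + q)) * (1 - (q + q)) =
    1 - (q + q + q + q) + (q * q + q * q + q * q + q * q) by ncring.
  by rewrite qq; ncring.
have -> : 1 - q + c%:C *: q =
    ((1 + c) / 2)%:C *: (1 : A) + ((1 - c) / 2)%:C *: (1 - (q + q)).
  rewrite scalerBr -scalr2 scalrA.
  have -> : (1 - c) / 2 * 2 = 1 - c by rewrite divfK ?pnatr_eq0.
  rewrite [X in _ = _ + (_ - X *: _)]rmorphB scalerBl scale1r addrA -scalerDl -rmorphD.
  have -> : (1 + c) / 2 + (1 - c) / 2 = 1 :> R by field.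
  by rewrite scale1r; ncring.
apply: le_trans (nrD _ _) _; rewrite !nrZr.
move: c1; rewrite ler_norml => /andP[c1 c2].
rewrite !ger0_norm; [|rlra|rlra].
have := nr1; move: u1; rnra.
Qed.

(** Up to the factor [m], the combination is the product of the contractions 1 - p_i + d_i p_i with
    d_i = c_i / m. The triangle inequality would only give the sum of the |c_i|. *)
Lemma nr_comb (c : I -> R) (m : R) : 0 <= m ->
  (forall i, p i != 0 -> `|c i| <= m) -> nr (comb (fun i => (c i)%:C)) <= m.
Proof.
move=> m0 hc; have [P O S1] := pu.
(* The divisor is [m], replaced by 1 when [m] is 0. *)
have m10 : 0 < m + (m == 0)%:R by case: eqP => [->|/eqP n0] /=; rewrite ?add0r ?addr0 // lt_def n0.
pose d i := if p i == 0 then 0 else c i / (m + (m == 0)%:R).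
have d1 i : `|d i| <= 1.
  rewrite /d; case: eqP => [_|/eqP pi]; first by rewrite normr0.
  rewrite normrM normfV (gtr0_norm m10) ler_pdivrMr // mul1r.
  by apply: le_trans (hc i pi) _; rewrite lerDl.
pose u (r : seq I) := \prod_(i <- r) (1 - p i + (d i)%:C *: p i).
have u1 (r : seq I) : nr (u r) <= 1.
  elim: r => [|i r IH]; rewrite /u ?big_nil ?big_cons ?nr1 //.
  by rewrite -[X in _ <= X](mulr1 1); apply: nrM_le => //; exact: nr_contract.
have up (r : seq I) j : uniq r -> u r * p j = if j \in r then (d j)%:C *: p j else p j.
  elim: r => [|i r IH]; first by rewrite /u big_nil mul1r.
  rewrite /= => /andP[ir ur]; rewrite /u big_cons -mulrA -/(u r) IH // inE.
  have E : (1 - p i + (d i)%:C *: p i) * p j = if j == i then (d j)%:C *: p j else p j.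
    rewrite mulrDl mulrBl mul1r scalAl partition_mul (eq_sym j).
    by case: eqP => [->|_]; rewrite ?subrr ?add0r // scaler0 subr0 addr0.
  case: (eqVneq j i) => [ji|ji] /=; first by subst j; move: E; rewrite (negbTE ir) eqxx.
  by move: E; rewrite (negbTE ji) => E; case: ifP => _ //; rewrite scalAr E.
have -> : comb (fun i => (c i)%:C) = m%:C *: u (index_enum I).
  rewrite -(mulr1 (u _)) -S1 mulr_sumr scaler_sumr; apply: eq_bigr => i _.
  rewrite up ?index_enum_uniq // mem_index_enum scalrA /d.
  have [->|pi] := eqVneq (p i) 0; first by rewrite !scaler0.
  congr (_%:C *: _); have [m00|mn0] := eqVneq m 0.
    have := hc i pi; rewrite m00 normr_le0 => /eqP ->; by rewrite mul0r.
  by rewrite /= addr0 mulrC divfK.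
rewrite nrZr ger0_norm // ler_piMr //.
Qed.

Lemma comb_proj (b : I -> bool) : projection (comb (fun i => ((b i)%:R : R)%:C)).
Proof.
split; first exact: star_comb.
rewrite /is_idempotent combM; apply: eq_bigr => i _; congr (_ *: _).
by case: (b i); rewrite ?mulr1 // mulr0.
Qed.

End Partition.

(** * Simple elements of a commutative subalgebra and their density *)

Definition simple (M : set A) z := exists (I : finType) (p : I -> A) (c : I -> R[i]),
  [/\ partition_of_unity p, forall i, M (p i) & z = comb p c].

(** The common refinement consists of the products p_i q_j, which are projections because [M] is
    commutative. *)
Lemma simple_common M z w : commutative_selfadjoint_subalgebra M ->
  simple M z -> simple M w -> exists (I : finType) (p : I -> A) (c d : I -> R[i]),
  [/\ partition_of_unity p, forall i, M (p i), z = comb p c & w = comb p d].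
Proof.
move=> [[_ _ _ MM] _ Mc] [I [p [c [pu Mp ->]]]] [J [q [d [qu Mq ->]]]].
have [P Op S1] := pu; have [Q Oq T1] := qu.
exists (I * J)%type, (fun ij => p ij.1 * q ij.2), (fun ij => c ij.1), (fun ij => d ij.2).
split.
- split.
  + move=> [i j] /=; have [sp pp] := P i; have [sq qq] := Q j; split.
      by rewrite star_mul sp sq Mc.
    rewrite /is_idempotent mulrA -(mulrA (p i)) (Mc (q j)) // (mulrA (p i)) pp.
    by rewrite -mulrA qq.
  + move=> [i j] [i' j'] /=; rewrite mulrA -(mulrA (p i)) (Mc (q j)) // (mulrA (p i)).
    have [->|ii] := eqVneq i i'; last by rewrite Op // !mul0r.
    rewrite xpair_eqE eqxx /= => jj; by rewrite -mulrA Oq // mulr0.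
  + rewrite -(pair_bigA _ (fun i j => p i * q j)) /= -S1; apply: eq_bigr => i _.
    by rewrite -mulr_sumr T1 mulr1.
- by move=> [i j] /=; apply: MM.
- rewrite /comb -(pair_bigA _ (fun i j => c i *: (p i * q j))) /=; apply: eq_bigr => i _.
  by rewrite -scaler_sumr -mulr_sumr T1 mulr1.
- rewrite /comb -(pair_bigA _ (fun i j => d j *: (p i * q j))) /= exchange_big /=.
  apply: eq_bigr => j _; by rewrite -scaler_sumr -mulr_suml S1 mul1r.
Qed.

(** The limits of simple elements form a closed subalgebra [D] containing the projections of [M],
    hence the subalgebra generated by them, which is [M] by axiom (B). *)
Lemma simple_dense M z : AWstar A -> maximal_commutative_selfadjoint_subalgebra M ->
  M z -> forall d : R, 0 < d -> exists2 s, simple M s & nr (z - s) <= d.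
Proof.
move=> [_ gen] mM Mz; have csa := mM.1; have [[M0 MD MZ MM] Ms Mc] := csa.
have M1 : M 1 by rewrite -(masa_bicommutant mM) => y _; rewrite mul1r mulr1.
have MN x : M x -> M (- x) by move=> Mx; rewrite -scaleN1r; exact: MZ.
have S0 (k : R[i]) : simple M (k *: (1 : A)).
  exists unit, (fun=> 1), (fun=> k); split=> //; last by rewrite /comb big_const card_unit /= addr0.
  split=> [_|[] []//|]; first exact: projection1.
  by rewrite big_const card_unit /= addr0.
pose D := [set z | forall d : R, 0 < d -> exists2 s, simple M s & nr (z - s) <= d].
suff : generated_subalgebra [set E | M E /\ projection E] `<=` D.
  by rewrite -(gen _ mM); apply.
apply: smallest_sub; last first.
  move=> E [ME pE] d d0; exists E; last by rewrite subrr nr0 ltW.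
  have [sE EE] := pE.
  exists bool, (fun b => if b then E else 1 - E), (fun b => if b then 1 else 0); split.
  - split.
    + case=> //; split; first by rewrite starB star1 sE.
      rewrite /is_idempotent; have -> : (1 - E) * (1 - E) = 1 - E - E + E * E by ncring.
      by rewrite EE; ncring.
    + by case; case=> // _; rewrite ?mulrBl ?mulrBr ?mul1r ?mulr1 EE subrr.
    + by rewrite big_bool /= addrC subrK.
  - by case=> //; apply: MD => //; exact: MN.
  - by rewrite /comb big_bool /= scale1r scale0r addr0.
split.
  move=> x hx d d0.
  have d2 : 0 < d / 2 by rewrite divr_gt0.
  have dC : 0 < (d / 2)%:C by rewrite ltcR.
  have [y [yD]] := hx _ (nbhsx_ballx x _ dC).
  rewrite -ball_normE /= normE ltcR => xy.
  have [s Ss ys] := yD _ d2; exists s => //.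
  have -> : x - s = (x - y) + (y - s) by ncring.
  by have := nrD (x - y) (y - s); rlra.
split.
- by move=> d d0; exists 0; [rewrite -[X in simple _ X](scale0r (1 : A)); exact: S0 | rewrite subrr nr0 ltW].
- move=> x y hx hy d d0.
  have [s Ss sx] := hx _ (divr_gt0 d0 (ltr0Sn _ 1)).
  have [t St ty] := hy _ (divr_gt0 d0 (ltr0Sn _ 1)).
  exists (s + t).
    have [I [p [c [e [pu Mp -> ->]]]]] := simple_common csa Ss St.
    exists I, p, (fun i => c i + e i); split=> //.
    by rewrite /comb -big_split; apply: eq_bigr => i _; rewrite scalerDl.
  have -> : x + y - (s + t) = (x - s) + (y - t) by ncring.
  apply: le_trans (nrD _ _) _; lra.
- move=> k x hx d d0; set a := complex.Re `|k|.
  have a0 : 0 <= a by have := normr_ge0 k; rewrite lecE => /andP[].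
  have d1 : 0 < d / (a + 1) by rewrite divr_gt0 //; lra.
  have [s [I [p [c [pu Mp ->]]]] sx] := hx _ d1.
  exists (k *: comb p c).
    exists I, p, (fun i => k * c i); split=> //.
    by rewrite /comb scaler_sumr; apply: eq_bigr => i _; rewrite scalerA.
  rewrite -scalerBr nrZ -/a; move: sx; rewrite ler_pdivlMr; last lra.
  have := nr_ge0 (x - comb p c); nra.
- move=> x y hx hy d d0.
  have b0 : 0 < nr x + nr y + d + 1 by have := nr_ge0 x; have := nr_ge0 y; lra.
  (* With q = d / b one has q <= d, so the error of the product is at most q (|x| + |y| + q) <= q b
     = d. *)
  set b := nr x + nr y + d + 1 in b0.
  have [s Ss sx] := hx _ (divr_gt0 d0 b0).
  have [t St ty] := hy _ (divr_gt0 d0 b0).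
  exists (s * t).
    have [I [p [c [e [pu Mp -> ->]]]]] := simple_common csa Ss St.
    exists I, p, (fun i => c i * e i); split=> //.
    by rewrite combM.
  have -> : x * y - s * t = (x - s) * y + x * (y - t) - (x - s) * (y - t) by ncring.
  have := nrB ((x - s) * y + x * (y - t)) ((x - s) * (y - t)).
  have := nrD ((x - s) * y) (x * (y - t)).
  have := nrM_le sx (lexx (nr y)); have := nrM_le (lexx (nr x)) ty.
  have := nrM_le sx ty.
  have : d / b * b = d by rewrite divfK ?gt_eqF.
  have : 0 < d / b by rewrite divr_gt0.
  have : d / b <= d.
    rewrite ler_pdivrMr // ler_peMr ?ltW // /b.
    have := nr_ge0 x; have := nr_ge0 y; lra.
  rewrite /b; set q := d / _ => q1 q2 q3 q4 q5 q6 q7 q8.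
  have : q * q <= q * d by rewrite ler_pM2l.
  rnra.
Qed.

(** Taking real parts of the coefficients replaces the approximation s by (s + s^* ) / 2, which is
    no farther from the self-adjoint [h]. *)
Lemma real_simple_dense M h (d : R) : AWstar A ->
  maximal_commutative_selfadjoint_subalgebra M -> M h -> star h = h -> 0 < d ->
  exists (I : finType) (p : I -> A) (l : I -> R), [/\ partition_of_unity p,
    forall i, M (p i) & nr (h - comb p (fun i => (l i)%:C)) <= d].
Proof.
move=> hA mM Mh sh d0.
have [_ [I [p [c [pu Mp ->]]]] hs] := simple_dense hA mM Mh d0.
exists I, p, (fun i => complex.Re (c i)); split=> //.
have -> : h - comb p (fun i => (complex.Re (c i))%:C) =
    2^-1%:C *: ((h - comb p c) + star (h - comb p c)).
  have e : comb p (fun i => (complex.Re (c i))%:C) = 2^-1%:C *: (comb p c + star (comb p c)).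
    rewrite /comb (big_morph star starD star0) -big_split scaler_sumr.
    apply: eq_bigr => i _; have [P _ _] := pu; have [sp _] := P i.
    rewrite /= starZ sp -scalerDl scalerA; congr (_ *: _).
    case: (c i) => a b; apply/eqP; rewrite eq_complex /= /conjc /=.
    by apply/andP; split; apply/eqP => /=; field.
  rewrite e starB sh.
  have -> : h - comb p c + (h - star (comb p c)) = (h + h) - (comb p c + star (comb p c)) by ncring.
  by rewrite scalerBr -scalr2 scalrA mulVf ?pnatr_eq0 // scale1r.
rewrite nrZr ger0_norm ?invr_ge0 //.
have := nrD (h - comb p c) (star (h - comb p c)); rewrite nr_star; rlra.
Qed.

(** * Partial isometries and approximate polar decomposition *)

Lemma sa_mul_id p (k : A) : star p = p -> star k = k -> k * p = k -> p * k = k.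
Proof. by move=> sp sk kp; rewrite -[RHS]sk -[in RHS]kp star_mul sk sp. Qed.

Lemma pi_source (v : A) : projection (star v * v) -> v * (star v * v) = v.
Proof.
move=> [_ hp]; apply/eqP; rewrite -subr_eq0; apply/eqP/nr_eq0/eqP.
rewrite -sqrf_eq0 -nr_starM starB !star_mul starK.
set q := star v * v in hp *.
have -> : (q * star v - star v) * (v * q - v) = q * q * q - q * q - (q * q - q).
  rewrite /q; ncring.
by rewrite !hp !subrr nr0.
Qed.

Lemma pi_final (v : A) : projection (star v * v) -> projection (v * star v).
Proof.
move=> h; split; first by rewrite star_mul starK.
by rewrite /is_idempotent mulrA -(mulrA v) pi_source.
Qed.

(* A polar decomposition of [x] on the spectral projection [g] of [x^*x] for
   values above [m]; [b] inverts [x] there. *)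
Lemma polar_cut x (m : R) : AWstar A -> 0 < m -> exists g f v b : A,
  [/\ projection g, projection f, star v * v = g & v * star v = f] /\
  [/\ b * x = g, x * b = f, g * b = b & b * f = b] /\
  nr b ^+ 2 <= m^-1 /\ nr (x * (1 - g)) ^+ 2 <= 2 * m.
Proof.
move=> hA m0; set h := star x * x.
have sh : star h = h by rewrite /h star_mul starK.
have [M mM Mh] := masa_exists sh.
have m20 : 0 < m / 2 by rewrite divr_gt0.
have [I [p [l [pu Mp hs]]]] := real_simple_dense hA mM Mh sh m20.
have [_ _ Mc] := mM.1.
have hp i : h * p i = p i * h by exact: Mc.
have [P O S1] := pu.
(* Otherwise [- h] is bounded below on the corner of [p i]; with [k] its inverse square root there,
   the square of [x k] would be [- p i], and [star_mul_neq_opp_proj] forces [p i] to be 0. *)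
have neg i : p i != 0 -> - (m / 2) <= l i.
  move=> p0; rewrite leNgt; apply/negP => li; case/eqP: p0.
  have hi : nr ((- l i)%:C *: p i - (- (h * p i))) <= - l i - (- l i - m / 2).
    have -> : (- l i)%:C *: p i - (- (h * p i)) = (h - comb p (fun i => (l i)%:C)) * p i.
      by rewrite mulrBl comb_mul // rmorphN scaleNr; ncring.
    apply: le_trans (nrM_le hs (nr_proj (P i))) _; rlra.
  have [sp pp] := P i.
  have s1 : star (- (h * p i)) = - (h * p i) by rewrite starN star_mul sp sh hp.
  have s2 : - (h * p i) * p i = - (h * p i) by rewrite mulNr -mulrA pp.
  have lm : 0 < - l i - m / 2 <= - l i by rlra.
  have [k [sk kp kc khk _]] := corner_inv_sqrt (P i) s1 s2 lm hi.
  have pk : p i * k = k by exact: sa_mul_id.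
  have e : star (x * k) * (x * k) = - p i.
    have e0 : k * h * k = - p i.
      by rewrite -[in RHS]khk mulrN mulNr opprK -!mulrA pk.
    by rewrite star_mul sk mulrA -(mulrA k) -/h e0.
  have xk := star_mul_neq_opp_proj (P i) e.
  by apply/eqP; rewrite -oppr_eq0 -e xk mulr0.
(* As [h] is within m / 2 of the combination, the threshold 3 m / 2 makes [h] at least m on [g] and
   at most 2 m on its complement. *)
pose b i := 3 / 2 * m < l i.
pose c i : R := (b i)%:R.
set s := comb p (fun i => (l i)%:C) in hs.
set g := comb p (fun i => (c i)%:C).
have gP : projection g by exact: comb_proj.
have [sg gg] := gP.
have hg : h * g = g * h.
  rewrite /g /comb mulr_sumr mulr_suml; apply: eq_bigr => i _.
  by rewrite scalAl scalAr hp.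
have g1 : nr (1 - g) <= 1.
  apply: nr_proj; split; first by rewrite starB star1 sg.
  rewrite /is_idempotent; have -> : (1 - g) * (1 - g) = 1 - g - g + g * g by ncring.
  by rewrite gg; ncring.
have low : nr (h * (1 - g)) <= 2 * m.
  have -> : h * (1 - g) = (h - s) * (1 - g) + s * (1 - g) by ncring.
  have e : s * (1 - g) = comb p (fun i => (l i * (1 - c i))%:C).
    rewrite -(comb1 pu) combB combM //; apply: eq_bigr => i _.
    by rewrite rmorphM rmorphB.
  have := nrD ((h - s) * (1 - g)) (s * (1 - g)).
  have := nrM_le hs g1.
  have : nr (s * (1 - g)) <= 3 / 2 * m.
    rewrite e; apply: nr_comb => //; first by rlra.
    move=> i /neg li; rewrite /c /b ler_norml; case: ltP => /= bi.
      by rewrite subrr mulr0; apply/andP; split; rlra.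
    by rewrite subr0 mulr1; apply/andP; split; rlra.
  rlra.
(* [t] dominates all coefficients, which bounds t g - h g by t - m; the summand 2 m keeps t - 3 m /
   2 nonnegative even if no coefficient passes the threshold. *)
pose t := \sum_i `|l i| + 2 * m.
have lt i : `|l i| <= t - 2 * m.
  rewrite /t addrK (bigD1 i) //= lerDl sumr_ge0 //.
have t2 : 2 * m <= t by rewrite /t lerDr sumr_ge0.
have high : nr (t%:C *: g - h * g) <= t - m.
  have -> : t%:C *: g - h * g = comb p (fun i => ((t - l i) * c i)%:C) - (h - s) * g.
    have -> : comb p (fun i => ((t - l i) * c i)%:C) = t%:C *: g - s * g.
      rewrite /s /g combM // /comb scaler_sumr -sumrB; apply: eq_bigr => i _.
      by rewrite scalerA -scalerBl rmorphM rmorphB mulrBl.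
    by ncring.
  have := nrB (comb p (fun i => ((t - l i) * c i)%:C)) ((h - s) * g).
  have := nrM_le hs (nr_proj gP).
  have : nr (comb p (fun i => ((t - l i) * c i)%:C)) <= t - 3 / 2 * m.
    apply: nr_comb => //; first by rlra.
    move=> i _; rewrite /c /b ler_norml; have := lt i; rewrite ler_norml => /andP[l1 l2].
    case: ltP => /= bi; rewrite ?mulr0 ?mulr1; apply/andP; split; rlra.
  rlra.
have s1 : star (h * g) = h * g by rewrite star_mul sg sh hg.
have s2 : h * g * g = h * g by rewrite -mulrA gg.
have lm : 0 < m <= t by rlra.
have [k [sk kg kc khk kn]] := corner_inv_sqrt gP s1 s2 lm high.
have gk : g * k = k by exact: sa_mul_id.
have {}khk : k * h * k = g by rewrite -[in RHS]khk -!mulrA gk.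
have vv : star (x * k) * (x * k) = g by rewrite star_mul sk mulrA -(mulrA k) khk.
have vP : projection (star (x * k) * (x * k)) by rewrite vv.
have fE : x * k * star (x * k) = x * (k * k * star x) by rewrite star_mul sk !mulrA.
have kkh : k * k * h = g.
  have c1 : h * g * k = k * (h * g) by apply: kc => //; rewrite s2 mulrA -hg s2.
  by rewrite -khk -(mulrA k k h) -(mulrA k h k); congr (k * _); rewrite -[in RHS]gk (mulrA h) c1 hg (mulrA k g) kg.
(* Here [k] is the inverse square root of [h] on [g], so [x k] is the isometric factor, and k^2 h =
   g makes [k * k * star x] a left inverse. *)
exists g, (x * k * star (x * k)), (x * k), (k * k * star x); split; [|split; [|split]].
- by split=> //; exact: pi_final.
- split; first by rewrite -mulrA.
  + by rewrite fE.
  + by rewrite !mulrA gk.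
  + rewrite fE !mulrA -(mulrA (k * k)) kkh; by rewrite gk.
- have -> : k * k * star x = k * star (x * k) by rewrite star_mul sk mulrA.
  apply: le_trans kn; rewrite ler_pXn2r ?nnegrE ?nr_ge0 //.
  apply: le_trans (nrM_le (lexx _) (_ : _ <= 1)) _; last by rewrite mulr1.
  by rewrite nr_star; apply: nr_piso.
- rewrite -nr_starM star_mul starB star1 sg mulrA -(mulrA (1 - g)) -/h -mulrA.
  by apply: le_trans (nrM_le g1 low) _; rewrite mul1r.
Qed.

(** * Comparison of projections *)

Lemma star_inj x y : star x = star y -> x = y.
Proof. by move=> h; rewrite -(starK x) h starK. Qed.

Lemma star_eq0 x : star x = 0 -> x = 0.
Proof. by move=> h; rewrite -(starK x) h star0. Qed.

Lemma star_sq_eq0 x : star x * x = 0 -> x = 0.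
Proof.
move=> h; apply: nr_eq0; apply/eqP; rewrite -sqrf_eq0 -nr_starM h; apply/eqP; exact: nr0.
Qed.

Lemma star_sqr_eq0 x : x * star x = 0 -> x = 0.
Proof. by move=> h; apply: star_eq0; apply: star_sq_eq0; rewrite starK. Qed.

Lemma proj_leC e f : projection e -> projection f -> proj_le e f -> f * e = e.
Proof. by move=> [se _] [sf _] /(congr1 star); rewrite star_mul se sf. Qed.

Lemma projectionB e f : projection e -> projection f -> proj_le e f -> projection (f - e).
Proof.
move=> pe pf ef; have fe := proj_leC pe pf ef.
have [se ee] := pe; have [sf ff] := pf; split; first by rewrite starB se sf.
by rewrite /is_idempotent mulrBl !mulrBr ff fe ee ef; ncring.
Qed.

Lemma projectionC e : projection e -> projection (1 - e).
Proof.
move=> pe; apply: projectionB => //; [exact: projection1 | exact: mulr1].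
Qed.

Lemma proj_orthC e f : projection e -> projection f -> e * f = 0 -> f * e = 0.
Proof. by move=> [se _] [sf _] /(congr1 star); rewrite star_mul se sf star0. Qed.

Lemma projectionD e f : projection e -> projection f -> e * f = 0 -> projection (e + f).
Proof.
move=> pe pf ef; have fe := proj_orthC pe pf ef.
have [se ee] := pe; have [sf ff] := pf; split; first by rewrite starD se sf.
by rewrite /is_idempotent mulrDl !mulrDr ff fe ee ef; ncring.
Qed.

Lemma proj_equiv_sym e f : proj_equiv e f -> proj_equiv f e.
Proof.
move=> [v [pv <- <-]]; exists (star v); split; rewrite ?starK //.
by rewrite /partial_isometry starK; exact: pi_final.
Qed.

Lemma equiv_proj e f : proj_equiv e f -> projection e /\ projection f.
Proof. by move=> [v [pv <- <-]]; split=> //; exact: pi_final. Qed.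

Lemma pi_final_id (v : A) : projection (star v * v) -> v * star v * v = v.
Proof. by move=> h; rewrite -mulrA pi_source. Qed.

Lemma proj_equivD e f e' f' : proj_equiv e f -> proj_equiv e' f' ->
  e * e' = 0 -> f * f' = 0 -> proj_equiv (e + e') (f + f').
Proof.
move=> ef ef' ee ff; have [pe pf] := equiv_proj ef; have [pe' pf'] := equiv_proj ef'.
move: ef ef' => [v [pv hv hv']] [w [pw hw hw']].
have vw : v * star w = 0.
  by rewrite -(pi_source pv) hv -(pi_source pw) hw star_mul pe'.1 mulrA -(mulrA v) ee mulr0 mul0r.
have wv : w * star v = 0 by rewrite -(starK (w * star v)) star_mul starK vw star0.
have vw' : star v * w = 0.
  by rewrite -(pi_final_id pv) hv' -(pi_final_id pw) hw' star_mul pf.1 -mulrA (mulrA f) ff mul0r mulr0.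
have wv' : star w * v = 0 by rewrite -(starK (star w * v)) star_mul starK vw' star0.
have e1 : star (v + w) * (v + w) = e + e'.
  by rewrite starD mulrDl !mulrDr hv hw vw' wv' addr0 add0r.
exists (v + w); split=> //; first by rewrite /partial_isometry e1; exact: projectionD.
by rewrite starD mulrDl !mulrDr hv' hw' vw wv addr0 add0r.
Qed.

Lemma proj_equiv_restrict (v e : A) : projection (star v * v) -> projection e ->
  proj_le e (star v * v) ->
  [/\ proj_equiv e (v * e * star v), projection (v * e * star v)
    & proj_le (v * e * star v) (v * star v)].
Proof.
move=> pv pe le; have [se ee] := pe; have le' := proj_leC pe pv le.
have h : proj_equiv e (v * e * star v).
  exists (v * e); rewrite /partial_isometry star_mul se -mulrA (mulrA (star v)) le' ee.
  by split=> //; rewrite !mulrA -(mulrA v e) ee.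
split=> //; first by have [] := equiv_proj h.
by rewrite /proj_le -!mulrA (mulrA (star v)) (mulrA e) le.
Qed.

(* Each spectral projection [g = b x] of [x^*x] kills [S], hence its supremum. *)
Lemma lub_annihilates (S : set A) s x : AWstar A -> proj_lub S s ->
  (forall e, S e -> projection e) -> (forall e, S e -> x * e = 0) -> x * s = 0.
Proof.
move=> hA [ps us ls] Sp Sx; apply: eps_eq => d d0; rewrite subr0.
have m0 : 0 < d ^+ 2 / 2 by rewrite divr_gt0 ?exprn_gt0.
have [g [f [v [b [[pg _ _ _] [[bx _ _ _] [_ hx]]]]]]] := polar_cut x hA m0.
have le : proj_le s (1 - g).
  apply: ls => [|e Se]; first exact: projectionC.
  rewrite /proj_le mulrBr mulr1 (proj_orthC pg (Sp _ Se)) ?subr0 //.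
  by rewrite -bx -mulrA Sx // mulr0.
have gs : g * s = 0.
  apply: (proj_orthC ps pg); move: le; rewrite /proj_le mulrBr mulr1.
  by rewrite -[X in _ = X]subr0 => /addrI/oppr_inj.
have -> : x * s = x * (1 - g) * s by rewrite mulrBr mulr1 mulrBl -(mulrA x) gs mulr0 subr0.
have hd : nr (x * (1 - g)) <= d.
  rewrite -(ler_pXn2r (ltn0Sn 1)) ?nnegrE ?nr_ge0 ?(ltW d0) //.
  apply: le_trans hx _; by rewrite mulrC divfK ?pnatr_eq0.
by apply: le_trans (nrM_le hd (nr_proj ps)) _; rewrite mulr1.
Qed.

(* Kaplansky: the partial isometry from [e1] to [f1] is [2 f1 g e1], with [g] the
   supremum of the projections [(w^* w + w w^* + w + w^* ) / 2] on the graphs of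
   the [w] in [W]. *)
Lemma sum_partial_isometries (W : set A) (e f : A) : AWstar A ->
  projection e -> projection f -> e * f = 0 ->
  (forall w, W w -> [/\ projection (star w * w), f * w = w & w * e = w]) ->
  (forall w w', W w -> W w' -> w <> w' -> w * star w' = 0 /\ star w * w' = 0) ->
  exists e1 f1, [/\ proj_equiv e1 f1, proj_le e1 e, proj_le f1 f,
    forall w, W w -> w * e1 = w & forall w, W w -> f1 * w = w].
Proof.
move=> hA pe pf ef hW oW; have fe := proj_orthC pe pf ef.
have eW w : W w -> e * star w = star w.
  by move=> /hW [_ _ h]; rewrite -[in RHS]h star_mul pe.1.
have fW w : W w -> star w * f = star w.
  by move=> /hW [_ h _]; rewrite -[in RHS]h star_mul pf.1.
have ww0 w w' : W w -> W w' -> w * w' = 0.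
  move=> /hW[_ _ h] /hW[_ h' _]; by rewrite -h -h' mulrA -(mulrA w) ef mulr0 mul0r.
have sw0 w w' : W w -> W w' -> star w * star w' = 0.
  by move=> a b; rewrite -star_mul ww0 // star0.
pose Se := [set star w * w | w in W]; pose Sf := [set w * star w | w in W].
pose a w : A := star w * w + w * star w + w + star w.
pose b w : A := star w * w + w * star w - w - star w.
pose Sg := [set 2^-1%:C *: a w | w in W].
have www w : W w -> w * star w * w = w by move=> /hW[h _ _]; exact: pi_final_id.
have sws w : W w -> star w * w * star w = star w.
  by move=> /www /(congr1 star); rewrite !star_mul starK mulrA.
(* Reduction rules for words in [w] and [star w]; the versions with a tail [z] apply inside
   right-associated products. *)
have nf w : W w -> [/\ w * (star w * w) = w, star w * (w * star w) = star w,
    forall z, w * (star w * (w * z)) = w * z,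
    forall z, star w * (w * (star w * z)) = star w * z &
    [/\ forall z, w * (w * z) = 0, forall z, star w * (star w * z) = 0, w * w = 0
      & star w * star w = 0]].
  move=> Ww; split=> [||z|z|]; rewrite ?mulrA ?www ?sws //.
  by split=> [z|z||]; rewrite ?mulrA ?(ww0 _ _ Ww Ww) ?(sw0 _ _ Ww Ww) ?mul0r.
have aa w : W w -> a w * a w = a w + a w.
  move=> /nf[n1 n2 n3 n4 [n5 n6 n7 n8]].
  rewrite /a !mulrDl !mulrDr -!mulrA !(n1, n2, n3, n4, n5, n6, n7, n8, mulr0).
  ncring.
have ab w : W w -> b w * a w = 0.
  move=> /nf[n1 n2 n3 n4 [n5 n6 n7 n8]].
  rewrite /a /b !mulrBl !mulrDl !mulrDr -!mulrA !(n1, n2, n3, n4, n5, n6, n7, n8, mulr0).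
  ncring.
have orth4 w w' : W w -> W w' -> w <> w' ->
   [/\ forall z, w * (star w' * z) = 0, forall z, star w * (w' * z) = 0,
       forall z, w * (w' * z) = 0 & forall z, star w * (star w' * z) = 0].
  move=> Ww Ww' ne; have [h1 h2] := oW _ _ Ww Ww' ne.
  by split=> z; rewrite mulrA ?h1 ?h2 ?(ww0 _ _ Ww Ww') ?(sw0 _ _ Ww Ww') mul0r.
have aax w w' : W w -> W w' -> w <> w' -> a w * a w' = 0.
  move=> Ww Ww' ne; have [h1 h2] := oW _ _ Ww Ww' ne; have [q1 q2 q3 q4] := orth4 _ _ Ww Ww' ne.
  rewrite /a !mulrDl !mulrDr -!mulrA !(q1, q2, q3, q4, h1, h2, ww0 _ _ Ww Ww', sw0 _ _ Ww Ww').
  by rewrite !mulr0 !addr0.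
have bax w w' : W w -> W w' -> w <> w' -> b w * a w' = 0.
  move=> Ww Ww' ne; have [h1 h2] := oW _ _ Ww Ww' ne; have [q1 q2 q3 q4] := orth4 _ _ Ww Ww' ne.
  rewrite /a /b !mulrBl !mulrDl !mulrDr -!mulrA !(q1, q2, q3, q4, h1, h2, ww0 _ _ Ww Ww', sw0 _ _ Ww Ww').
  by rewrite !mulr0 !addr0 !subr0.
have sa w : star (a w) = a w.
  by rewrite /a !starD !star_mul !starK -!addrA; congr (_ + (_ + _)); rewrite addrC.
have h2 : 2^-1%:C != 0 :> R[i] by rewrite (inj_eq (@complexI R) _ 0) invr_eq0 pnatr_eq0.
have pSe x : Se x -> projection x by move=> [w /hW[h _ _] <-].
have pSf x : Sf x -> projection x by move=> [w /hW[h _ _] <-]; exact: pi_final.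
have pSg x : Sg x -> projection x.
  move=> [w Ww <-]; split; first by rewrite starZr sa.
  rewrite /is_idempotent scalAl scalAr aa // -scalr2 (scalrA _ 2) mulVf ?pnatr_eq0 //.
  by rewrite scale1r.
have [E lE] : exists E, proj_lub Se E.
  apply: hA.1; split=> // _ _ [w Ww <-] [w' Ww' <-] ne.
  have nw : w <> w' by move=> h; apply: ne; rewrite h.
  by rewrite -mulrA (mulrA w) (oW _ _ Ww Ww' nw).1 mul0r mulr0.
have [F lF] : exists F, proj_lub Sf F.
  apply: hA.1; split=> // _ _ [w Ww <-] [w' Ww' <-] ne.
  have nw : w <> w' by move=> h; apply: ne; rewrite h.
  by rewrite -mulrA (mulrA (star w)) (oW _ _ Ww Ww' nw).2 mul0r mulr0.
have [G lG] : exists G, proj_lub Sg G.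
  apply: hA.1; split=> // _ _ [w Ww <-] [w' Ww' <-] ne.
  have nw : w <> w' by move=> h; apply: ne; rewrite h.
  by rewrite scalAl scalAr aax // !scaler0.
have [[sE EE] uE mE] := lE; have [[sF FF] uF mF] := lF; have [[sG GG] uG mG] := lG.
have Ee : proj_le E e.
  by apply: mE => // _ [w /hW[_ _ h] <-]; rewrite /proj_le -mulrA h.
have Ff : proj_le F f.
  by apply: mF => // _ [w /fW h <-]; rewrite /proj_le -mulrA h.
have wE w : W w -> w * E = w.
  move=> Ww; have [h _ _] := hW _ Ww.
  by rewrite -{1}(pi_source h) -mulrA uE ?pi_source //; exists w.
have Fw w : W w -> F * w = w.
  move=> Ww; have [h _ _] := hW _ Ww.
  have := uF (w * star w); rewrite /proj_le => /(_ _)/(congr1 star).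
  rewrite !star_mul starK sF => k; rewrite -{1}(pi_final_id h) mulrA k ?pi_final_id //.
  by exists w.
have Ga w : W w -> G * a w = a w.
  move=> Ww; apply: star_inj; rewrite star_mul sa sG.
  have := uG (2^-1%:C *: a w); rewrite /proj_le scalAl => /(_ _)/scalerI; apply=> //.
  by exists w.
have Gb w : W w -> G * b w = 0.
  move=> Ww; apply: star_inj; rewrite star_mul sG star0.
  have -> : star (b w) = b w.
    by rewrite /b !starB !starD !star_mul !starK; ncring.
  apply: (lub_annihilates hA lG) => // _ [w' Ww' <-]; rewrite scalAr.
  by case: (pselect (w = w')) => [<-|ne]; rewrite ?ab ?bax // scaler0.
(* [b w] is twice the projection on the graph of [- w], orthogonal to that of [w]. As [G] fixes
   [a w] and kills [b w], and their sum is twice w^* w + w w^*, the double of [G] maps w^* w + w w^*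
   to [a w]. *)
have Gsum w : W w -> (G + G) * (star w * w) = star w * w + w
    /\ (G + G) * (w * star w) = w * star w + star w.
  move=> Ww.
  have e2 : (G + G) * (star w * w + w * star w) = a w.
    have -> : (G + G) * (star w * w + w * star w) = G * a w + G * b w by rewrite /a /b; ncring.
    by rewrite Ga // Gb // addr0.
  have [n1 n2 n3 n4 [n5 n6 n7 n8]] := nf _ Ww.
  have e3 : (star w * w + w * star w) * (star w * w) = star w * w.
    by rewrite mulrDl -!mulrA !(n1, n6) mulr0 addr0.
  have e4 : (star w * w + w * star w) * (w * star w) = w * star w.
    by rewrite mulrDl -!mulrA !(n2, n5) mulr0 add0r.
  split; [rewrite -[in LHS]e3 | rewrite -[in LHS]e4]; rewrite (mulrA (G + G)) e2.
    by rewrite /a !mulrDl -!mulrA !(n1, n2, n3, n4, n5, n6, n7, n8, mulr0); ncring.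
  by rewrite /a !mulrDl -!mulrA !(n1, n2, n3, n4, n5, n6, n7, n8, mulr0); ncring.
have Fe w : W w -> F * (star w * w) = 0.
  move=> Ww; rewrite -Ff -(eW _ Ww) -!mulrA (mulrA f) fe mul0r mulr0 //.
have Ef w : W w -> E * (w * star w) = 0.
  move=> Ww; have [_ h _] := hW _ Ww.
  by rewrite -Ee -{1}h -!mulrA (mulrA e) ef mul0r mulr0.
pose V := F * (G + G) * E.
have sV : star V = E * (G + G) * F by rewrite /V !star_mul starD sE sF sG mulrA.
have Ew w : W w -> E * star w = star w by move=> Ww; rewrite -[in RHS](wE _ Ww) star_mul sE.
have Ve w : W w -> V * (star w * w) = w.
  move=> Ww; rewrite /V -(mulrA _ E) (mulrA E) Ew // -mulrA (Gsum _ Ww).1.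
  by rewrite mulrDr Fe // Fw // add0r.
have sVf w : W w -> star V * (w * star w) = star w.
  move=> Ww; rewrite sV -(mulrA _ F) (mulrA F) Fw // -mulrA (Gsum _ Ww).2.
  by rewrite mulrDr Ef // Ew // add0r.
have VE : V * E = V by rewrite /V -mulrA EE.
have VF : star V * F = star V by rewrite sV -mulrA FF.
(* The difference annihilates every w^* w, hence by [lub_annihilates] their supremum [E]. *)
have VV : star V * V = E.
  apply/eqP; rewrite -subr_eq0; apply/eqP.
  have -> : star V * V - E = (star V * V - E) * E by rewrite mulrBl EE -(mulrA (star V)) VE.
  apply: (lub_annihilates hA lE) => // _ [w Ww <-].
  rewrite mulrBl -(mulrA (star V)) Ve // (mulrA E) Ew //.
  by rewrite -{1}(www _ Ww) mulrA sVf // subrr.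
have VV' : V * star V = F.
  apply/eqP; rewrite -subr_eq0; apply/eqP.
  have -> : V * star V - F = (V * star V - F) * F by rewrite mulrBl FF -(mulrA V) VF.
  apply: (lub_annihilates hA lF) => // _ [w Ww <-].
  rewrite mulrBl -(mulrA V) sVf // (mulrA F) Fw //.
  by rewrite -{1}(sws _ Ww) mulrA Ve // subrr.
exists E, F; split=> //; exists V; split=> //.
by rewrite /partial_isometry VV.
Qed.

(** A maximal family of mutually orthogonal partial isometries from subprojections of [e] to
    subprojections of [f] is summed. A nonzero (f - f1) y (e - e1) would yield, by [polar_cut], one
    more partial isometry between the remainders. *)
Lemma comparability e f : AWstar A -> projection e -> projection f -> e * f = 0 ->
  exists e1 f1, [/\ proj_equiv e1 f1, proj_le e1 e, proj_le f1 f
    & forall y, (f - f1) * y * (e - e1) = 0].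
Proof.
move=> hA pe pf ef.
pose P (W : set A) :=
  (forall w, W w -> [/\ projection (star w * w), f * w = w & w * e = w]) /\
  (forall w w', W w -> W w' -> w <> w' -> w * star w' = 0 /\ star w * w' = 0).
have [] := @Zorn_bigcup A P.
  move=> F FP tF; split; first by move=> w [X FX Xw]; exact: (FP _ FX).1.
  move=> w w' [X FX Xw] [Y FY Yw].
  have [XY|YX] := tF _ _ FX FY.
    by apply: (FP _ FY).2 => //; exact: XY.
  by apply: (FP _ FX).2 => //; exact: YX.
move=> W [[hW oW] Wmax].
have [e1 [f1 [ee1 le1 lf1 We Wf]]] := sum_partial_isometries hA pe pf ef hW oW.
have [pe1 pf1] := equiv_proj ee1.
exists e1, f1; split=> // y; set x := (f - f1) * y * (e - e1).
case: (pselect (x = 0)) => // nx.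
have x0 : 0 < nr x.
  by rewrite lt_def nr_ge0 andbT; apply/eqP => /nr_eq0.
(* For this cut the neglected part has squared norm at most |x|^2 / 2, so the projection [g] cannot
   be 0. *)
have m0 : 0 < nr x ^+ 2 / 4 by rewrite divr_gt0 ?exprn_gt0.
have [g [h [v [b [[pg ph vv vv'] [[bx xb _ _] [_ hx]]]]]]] := polar_cut x hA m0.
have g0 : g <> 0.
  move=> g0; move: hx; rewrite g0 subr0 mulr1.
  have : 0 < nr x ^+ 2 by rewrite exprn_gt0.
  set q := nr x ^+ 2; lra.
have pE := projectionB pe1 pe le1; have pF := projectionB pf1 pf lf1.
have xE : x * (e - e1) = x by rewrite /x -mulrA pE.2.
have Fx : (f - f1) * x = x by rewrite /x !mulrA pF.2.
have pv : projection (star v * v) by rewrite vv.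
have vE : v * (e - e1) = v.
  by rewrite -(pi_source pv) vv -mulrA -bx -mulrA xE.
have Fv : (f - f1) * v = v.
  by rewrite -(pi_final_id pv) vv' mulrA -xb (mulrA (f - f1)) Fx.
have e1e := proj_leC pe1 pe le1; have f1f := proj_leC pf1 pf lf1.
have ve : v * e = v by rewrite -vE -mulrA mulrBl pe.2 le1.
have fv : f * v = v by rewrite -Fv mulrA mulrBr pf.2 f1f.
have vw w : W w -> v * star w = 0.
  move=> Ww; have [_ _ we] := hW _ Ww.
  have h1 : e * star w = star w by rewrite -[in RHS]we star_mul pe.1.
  have h2 : e1 * star w = star w by rewrite -[in RHS](We _ Ww) star_mul pe1.1.
  by rewrite -vE -mulrA mulrBl h1 h2 subrr mulr0.
have vw' w : W w -> star v * w = 0.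
  move=> Ww; have [_ fw _] := hW _ Ww.
  rewrite -Fv star_mul starB pf.1 pf1.1 -mulrA mulrBl fw Wf // subrr mulr0 //.
pose W' : set A := [set w | W w \/ w = v].
(* If [v] were already in [W] it would be orthogonal to itself, hence 0. *)
have [] := Wmax W'.
  split; first by move=> w Ww; left.
  move=> /(_ v (or_intror erefl)) /vw/star_sqr_eq0 v0; apply: g0; by rewrite -vv v0 mulr0.
split; first by move=> w [/hW //|->].
move=> w w' [Ww|->] [Ww'|->] ne //; first exact: oW.
- split; apply: star_inj; rewrite star_mul ?starK star0; [exact: vw | exact: vw'].
- by split; [exact: vw | exact: vw'].
Qed.

(* Otherwise the [t^n e t*^n], with [t] the adjoint of [w], are orthogonal; on
   their supremum [q] act by [t] and elsewhere by the identity. *)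
Lemma finite_disjoint_complement e f : AWstar A -> finite_projection (1 : A) ->
  projection e -> projection f -> proj_equiv (1 - e) (1 - f) ->
  (forall y, f * y * e = 0) -> e = 0.
Proof.
move=> hA [_ fin] pe pf [w [pw ww ww']] fe.
set t := star w.
have tt : star t * t = 1 - f by rewrite /t starK.
have tt' : t * star t = 1 - e by rewrite /t starK.
have [se ee] := pe; have [sf ff] := pf.
have et : e * t = 0.
  apply: star_sqr_eq0; rewrite star_mul se mulrA -(mulrA e) tt' mulrBr mulr1 ee subrr mul0r //.
pose u n := iter n (fun z => t * z) e.
have uS n : u n.+1 = t * u n by [].
(* Each [u n] lies in A e, which [f] annihilates from the left; so [t], isometric on 1 - f, acts
   isometrically on all of them. *)
have fu n : f * u n = 0.
  have [z ->] : exists z, u n = z * e.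
    elim: n => [|n [z IH]]; first by exists 1; rewrite mul1r.
    by exists (t * z); rewrite uS IH mulrA.
  by rewrite mulrA fe.
have tu n : star t * u n.+1 = u n.
  by rewrite uS mulrA tt mulrBl mul1r fu subr0.
have ue n : u n * e = u n.
  by elim: n => [|n IH]; rewrite ?uS -?mulrA ?IH.
have uu n : star (u n) * u n = e.
  elim: n => [|n IH]; first by rewrite /= se ee.
  by rewrite {1}uS star_mul -mulrA tu.
have uv n k : star (u n) * u (n + k.+1)%N = 0.
  elim: n => [|n IH]; first by rewrite add0n uS /= se mulrA et mul0r.
  by rewrite {1}uS star_mul addSn -mulrA tu.
have uv' n k : star (u (n + k.+1)%N) * u n = 0.
  by apply: star_inj; rewrite star_mul starK uv star0.
pose S := [set u n * star (u n) | n in [set: nat]].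
have pu n : projection (star (u n) * u n) by rewrite uu.
have pS x : S x -> projection x by move=> [n _ <-]; exact: pi_final.
have [q lq] : exists q, proj_lub S q.
  apply: hA.1; split=> // _ _ [n _ <-] [m _ <-] ne.
  rewrite -mulrA (mulrA (star (u n))); case: (ltngtP n m) => nm.
  - by rewrite -(subnKC nm) addSnnS uv mul0r mulr0.
  - by rewrite -(subnKC nm) addSnnS uv' mul0r mulr0.
  - by case: ne; rewrite nm.
have [pq uq mq] := lq; have [sq qq] := pq.
have qu n : q * u n = u n.
  have := uq (u n * star (u n)); rewrite /proj_le => /(_ _)/(congr1 star).
  rewrite !star_mul starK sq => h; rewrite -{1}(pi_final_id (pu n)) mulrA h ?pi_final_id //.
  by exists n.
have fq : f * q = 0.
  apply: (lub_annihilates hA lq) => // _ [n _ <-]; by rewrite mulrA fu mul0r.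
have tq : (1 - q) * t * q = 0.
  apply: (lub_annihilates hA lq) => // _ [n _ <-].
  by rewrite mulrA -(mulrA _ t) -uS mulrBl mul1r qu subrr mul0r.
have tq1 : t * q = q * t * q.
  by apply/eqP; rewrite -subr_eq0 -tq !mulrBl mul1r.
have tq2 : q * star t = q * star t * q.
  by have := congr1 star tq1; rewrite !star_mul sq mulrA.
(* [v] is an isometry, hence unitary by finiteness. But [e] lies under [q] and e t = 0, so e v = 0,
   which leaves only e = 0. *)
pose v := t * q + (1 - q).
have sv : star v = q * star t + (1 - q) by rewrite /v starD star_mul starB star1 sq.
have vv : star v * v = 1.
  have e1 : q * star t * (t * q) = q.
    by rewrite mulrA -(mulrA q) tt mulrBr mulr1 mulrBl qq -mulrA fq mulr0 subr0.
  have e2 : q * star t * (1 - q) = 0 by rewrite mulrBr mulr1 -tq2 subrr.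
  have e3 : (1 - q) * (t * q) = 0 by rewrite mulrA.
  have e4 : (1 - q) * (1 - q) = 1 - q := (projectionC pq).2.
  rewrite sv /v mulrDl (mulrDr (q * star t)) (mulrDr (1 - q)) e1 e2 e3 e4; ncring.
have pv : projection (star v * v) by rewrite vv; exact: projection1.
have : v * star v = 1.
  by apply: fin; [exact: pi_final | exact: mulr1 | exists v].
have -> : v * star v = t * q * star t + (1 - q).
  have e1 : t * q * (q * star t) = t * q * star t by rewrite mulrA -(mulrA t q q) qq.
  have e2 : t * q * (1 - q) = 0 by rewrite mulrBr mulr1 -mulrA qq subrr.
  have e3 : (1 - q) * (q * star t) = 0 by rewrite mulrA mulrBl mul1r qq subrr mul0r.
  have e4 : (1 - q) * (1 - q) = 1 - q := (projectionC pq).2.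
  rewrite sv /v mulrDl (mulrDr (t * q)) (mulrDr (1 - q)) e1 e2 e3 e4; ncring.
move=> /(congr1 (fun z => e * z)); rewrite mulrDr !mulrA et !mul0r add0r mulr1 mulrBr mulr1.
have eq : e * q = e.
  by have := uq (u 0%N * star (u 0%N)); rewrite /= se ee; apply; exists 0%N; rewrite //= se ee.
by rewrite eq subrr.
Qed.

(** Equivalent parts of [e] and [f] are split off until nothing is left. [polar_cut] of f e removes
    g and g', so that the remainders n and n' are nearly orthogonal. Comparability needs exact
    orthogonality, so n' is first carried to an equivalent projection n2 under 1 - n, and the result
    carried back. The final remainders have equivalent complements and satisfy the hypothesis of
    [finite_disjoint_complement], in both orders, so they vanish. *)
Lemma finite_cancellation e f : AWstar A -> finite_projection (1 : A) ->
  projection e -> projection f -> proj_equiv (1 - e) (1 - f) -> proj_equiv e f.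
Proof.
move=> hA fin pe pf hc.
(* Twice this cut is 1/16, so the neglected parts have norm at most 1/4. *)
have m0 : 0 < (32^-1 : R) by rewrite invr_gt0.
have [g [g' [v [b [[pg pg' vv vv'] [[bx xb _ _] [_ hx]]]]]]] := polar_cut (f * e) hA m0.
have pv : projection (star v * v) by rewrite vv.
have gg' : proj_equiv g g' by exists v.
have ge : proj_le g e by rewrite /proj_le -bx -!mulrA pe.2.
have gf : proj_le g' f.
  apply: star_inj; rewrite star_mul pg'.1 pf.1 -xb !mulrA pf.2 //.
pose n := e - g; pose n' := f - g'.
have pn : projection n by exact: projectionB.
have pn' : projection n' by exact: projectionB.
have nf : n' * f = n' by rewrite /n' mulrBl pf.2 gf.
have ne : e * (1 - g) = n by rewrite mulrBr mulr1 (proj_leC pg pe ge).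
have n'n : nr (n * n') <= 4^-1.
  rewrite -nr_star star_mul pn.1 pn'.1 -nf -ne -mulrA (mulrA f) -[X in _ <= X]mul1r.
  apply: nrM_le; first exact: nr_proj.
  rewrite -(ler_pXn2r (ltn0Sn 1)) ?nnegrE ?nr_ge0 ?invr_ge0 //.
  by apply: le_trans hx _; lra.
have [h [n2 [z [c [[ph pn2 zz zz'] [[cy yc _ _] [_ hy]]]]]]] := polar_cut ((1 - n) * n') hA m0.
have hn' : h * n' = h by rewrite -cy -!mulrA pn'.2.
have n'h : n' * h = h by apply: proj_leC.
(* The source of the second cut is all of n': for r = n' - h one gets |r| <= 1/4 + |r| / 4, so |r| <
   1, and a projection of norm below 1 is 0. *)
have {}hn' : h = n'.
  pose r := n' - h.
  have pr : projection r by exact: projectionB.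
  have n'r : n' * r = r by rewrite mulrBr pn'.2 n'h.
  have e1 : (1 - n) * n' * (1 - h) = (1 - n) * r by rewrite -mulrA mulrBr mulr1 n'h.
  have h1 : nr ((1 - n) * r) <= 4^-1.
    rewrite -e1 -(ler_pXn2r (ltn0Sn 1)) ?nnegrE ?nr_ge0 ?invr_ge0 //.
    by apply: le_trans hy _; lra.
  have h2 : nr (n * r) <= 4^-1 * nr r by rewrite -n'r mulrA n'r; exact: nrM_le.
  have h3 : nr r <= nr ((1 - n) * r) + nr (n * r).
    by apply: le_trans (nrD _ _); rewrite -mulrDl subrK mul1r.
  have h4 := nr_sqr pr.1; rewrite pr.2 in h4.
  have h5 := nr_ge0 r.
  have r0 : r = 0 by apply: nr_eq0; move: h1 h2 h3 h4 h5; set q := nr r; rnra.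
  by apply/eqP; rewrite eq_sym -subr_eq0 -/r r0.
have nn1 : n * (1 - n) = 0 by rewrite (mulrBr n) mulr1 pn.2 subrr.
have nn2 : n * n2 = 0 by rewrite -yc -!mulrA (mulrA n) nn1 mul0r.
have [e1 [f1 [ef1 le1 lf1 dis]]] := comparability hA pn pn2 nn2.
have [pe1 pf1] := equiv_proj ef1.
have psz : projection (star (star z) * star z) by rewrite starK zz'.
have lf1' : proj_le f1 (star (star z) * star z) by rewrite starK zz'.
have [ff1 pf1' lf1''] := proj_equiv_restrict psz pf1 lf1'.
rewrite !starK in ff1 pf1' lf1''; set f1' := star z * f1 * z in ff1 pf1' lf1''.
rewrite zz hn' in lf1''.
have eg : e * g = g := proj_leC pg pe ge.
have fg' : f * g' = g' := proj_leC pg' pf gf.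
have ne1 : n * e1 = e1 := proj_leC pe1 pn le1.
have n'f1 : n' * f1' = f1' := proj_leC pf1' pn' lf1''.
have ge1 : g * e1 = 0 by rewrite -ne1 mulrA mulrBr ge pg.2 subrr mul0r.
have gf1 : g' * f1' = 0 by rewrite -n'f1 mulrA mulrBr gf pg'.2 subrr mul0r.
have ge1' : (1 - e) * (g + e1) = 0.
  have en : e * n = n by rewrite /n mulrBr pe.2 eg.
  by rewrite -ne1 mulrBl mul1r mulrDr eg (mulrA e n) en subrr.
have gf1' : (1 - f) * (g' + f1') = 0.
  have fn : f * n' = n' by rewrite /n' mulrBr pf.2 fg'.
  by rewrite -n'f1 mulrBl mul1r mulrDr fg' (mulrA f n') fn subrr.
have ef2 : proj_equiv (g + e1) (g' + f1').
  apply: proj_equivD => //.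
  have [V [pV hV hV']] := ef1; have [U [pU hU hU']] := ff1.
  have VV : star V * V = e1 := hV.
  have fV : f1 * V = V by rewrite -hV' pi_final_id.
  have Uf : U * f1 = U by rewrite -hU pi_source.
  exists (U * V); rewrite /partial_isometry star_mul !mulrA -(mulrA _ (star U)) hU.
  rewrite -(mulrA (star V)) fV hV -(mulrA U) hV' Uf hU'; split=> //.
have hc2 := proj_equivD hc ef2 ge1' gf1'.
have E2 : 1 - e + (g + e1) = 1 - (n - e1) by rewrite /n; ncring.
have F2 : 1 - f + (g' + f1') = 1 - (n' - f1') by rewrite /n'; ncring.
rewrite E2 F2 in hc2.
have f2E : n' - f1' = star z * (n2 - f1) * z.
  rewrite mulrBr mulrBl -/f1' -zz' !mulrA zz hn' -mulrA zz hn' pn'.2 //.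
have dis2 y : (n' - f1') * y * (n - e1) = 0.
  have -> : (n' - f1') * y * (n - e1) = star z * ((n2 - f1) * (z * y) * (n - e1)).
    by rewrite f2E !mulrA.
  by rewrite dis mulr0.
have pe2 : projection (n - e1) by exact: projectionB.
have pf2 : projection (n' - f1') by exact: projectionB.
have e20 := finite_disjoint_complement hA fin pe2 pf2 hc2 dis2.
have f20 : n' - f1' = 0.
  apply: (finite_disjoint_complement hA fin pf2 pe2 (proj_equiv_sym hc2)) => y.
  apply: star_inj; rewrite !star_mul pe2.1 pf2.1 star0 mulrA; exact: dis2.
have -> : e = g + e1 by rewrite -[LHS](subrK g) -/n -[n](subrK e1) e20; ncring.
by have -> : f = g' + f1' by rewrite -[LHS](subrK g') -/n' -[n'](subrK f1') f20; ncring.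
Qed.

(** * The idempotent *)

(* Cut [x] by [polar_cut], and let [w] be a partial isometry between the
   complements of the two projections: the sum equals [x] where [x] is bounded
   below, and is close to [b w] on the rest. *)
Lemma invertible_perturbation x (b : R) : AWstar A -> finite_projection (1 : A) ->
  0 < b <= 1 -> exists w i, [/\ partial_isometry w,
    is_inverse (x + b%:C *: (w * (1 - star x * x))) i
    & forall p, projection p -> p * x = p -> x * p = p -> w * p = 0 /\ p * w = 0].
Proof.
move=> hA fin /andP[b0 b1].
(* This choice makes |x n| <= b / 2, where n is the complement of the source of the cut. *)
have m0 : 0 < b ^+ 2 / 8 by rewrite divr_gt0 ?exprn_gt0.
have [g [f [v [c [[pg pf vv vv'] [[cx xc gc cf] [_ hx]]]]]]] := polar_cut x hA m0.
have fx : f * x = x * g by rewrite -xc -cx mulrA.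
set h := star x * x.
have [sg gg] := pg; have [sf ff] := pf.
have gxs : g * star x = star x * f by rewrite -{1}sg -star_mul -fx star_mul sf.
have hg : h * g = g * h by rewrite /h -mulrA -fx !mulrA gxs.
set n := 1 - g; set n' := 1 - f.
have pn : projection n := projectionC pg.
have pn' : projection n' := projectionC pf.
have [sn nn] := pn; have [sn' nn'] := pn'.
have hn : h * n = n * h by rewrite /n mulrBr mulrBl mulr1 mul1r hg.
have ng : n * g = 0 by rewrite /n mulrBl mul1r gg subrr.
have gn : g * n = 0 by rewrite /n mulrBr mulr1 gg subrr.
have n'f : n' * f = 0 by rewrite /n' mulrBl mul1r ff subrr.
have fn' : f * n' = 0 by rewrite /n' mulrBr mulr1 ff subrr.
have n'x : n' * x = x * n by rewrite /n /n' mulrBl mulrBr mulr1 mul1r fx.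
have gE : g + n = 1 by rewrite /n; ncring.
have fE : f + n' = 1 by rewrite /n'; ncring.
have [w [pw ww ww']] : proj_equiv n n'.
  apply: finite_cancellation => //; have -> : 1 - n = g by rewrite /n; ncring.
  have -> : 1 - n' = f by rewrite /n'; ncring.
  by exists v; split=> //; rewrite /partial_isometry vv.
have wn : w * n = w by rewrite -ww pi_source.
have n'w : n' * w = w by rewrite -ww' pi_final_id.
have nws : n * star w = star w by rewrite -[in RHS]wn star_mul sn.
have wsn' : star w * n' = star w by rewrite -[in RHS]n'w star_mul sn'.
have xn : nr (x * n) <= b / 2.
  rewrite -(ler_pXn2r (ltn0Sn 1)) ?nnegrE ?nr_ge0 ?divr_ge0 ?(ltW b0) //.
  by apply: le_trans hx _; rewrite le_eqVlt; apply/orP; left; apply/eqP; field.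
have nhn : nr (h * n) <= 4^-1.
  have -> : h * n = star (x * n) * (x * n).
    by rewrite star_mul sn mulrA -(mulrA n) -/h -hn -mulrA nn.
  rewrite nr_starM; have := nr_ge0 (x * n); move: xn; set q := nr _; rnra.
(* On [n] the perturbed element is b w (1 - z), and |z| <= 1/4 + 1/2; on [g] it is still [x]. The
   inverse is assembled from [c] and b^-1 J w^* accordingly. *)
set z := h * n - b^-1%:C *: (star w * (x * n)).
have z1 : nr z < 1.
  have h1 : nr (star w * (x * n)) <= b / 2.
    rewrite -(mul1r (b / 2)); apply: nrM_le => //.
    by rewrite nr_star; apply: nr_piso.
  apply: le_lt_trans (nrB _ _) _; rewrite nrZr gtr0_norm ?invr_gt0 //.
  have : b^-1 * nr (star w * (x * n)) <= 2^-1.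
    by rewrite mulrC ler_pdivrMr // mulrC.
  by move: nhn; set q := nr (h * n); set q' := _ * nr _; rlra.
have [J [J1 J2 _ Jc]] := neumann z1.
have nz1 : n * z = z.
    by rewrite /z (mulrBr n) scalAr (mulrA n h) -hn -(mulrA h) nn (mulrA n (star w)) nws.
have zn1 : z * n = z.
  by rewrite /z mulrBl scalAl -(mulrA h) nn -(mulrA (star w)) -(mulrA x) nn.
have zn : n * z = z * n by rewrite nz1 zn1.
have nJ := Jc _ zn.
pose y := x + b%:C *: (w * (1 - h)).
have yg : y * g = x * g.
  have hg' : (1 - h) * g = g * (1 - h) by rewrite mulrBl mulrBr mul1r mulr1 hg.
  have wg : w * g = 0 by rewrite -wn -(mulrA w) ng mulr0.
  by rewrite /y mulrDl scalAl -(mulrA w) hg' (mulrA w) wg mul0r scaler0 addr0.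
have yn : y * n = b%:C *: (w * (1 - z) * n).
  have e1 : (1 - z) * n = (1 - h) * n + b^-1%:C *: (star w * (x * n)).
    by rewrite mulrBl mul1r zn1 (mulrBl n) mul1r /z; ncring.
  have e2 : w * (star w * (x * n)) = x * n.
    by rewrite mulrA ww' mulrA n'x -(mulrA x) nn.
  rewrite -(mulrA w) e1 (mulrDr w) scalAr e2 scalerDr scalrA divff ?gt_eqF //.
  by rewrite scale1r /y mulrDl scalAl -(mulrA w) addrC.
exists w, (c + b^-1%:C *: (J * star w)); split=> //; first split.
- have e1 : y * c = f by rewrite -gc mulrA yg -mulrA gc.
  have e2 : y * (J * star w) = b%:C *: n'.
    rewrite -nws (mulrA J) -nJ -(mulrA n) (mulrA y) yn scalAl -!mulrA (mulrA n J) nJ.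
    by rewrite -(mulrA J) nws (mulrA (1 - z)) J1 mul1r ww'.
  by rewrite mulrDr scalAr e1 e2 scalrA mulVf ?gt_eqF // scale1r.
- rewrite -/y -[y]mulr1 -gE mulrDr mulrDr yg yn.
  have e1 : (c + b^-1%:C *: (J * star w)) * (x * g) = g.
    rewrite mulrDl mulrA cx gg scalAl -fx -mulrA (mulrA (star w)) -wsn'.
    by rewrite -(mulrA (star w)) n'f mulr0 mul0r mulr0 scaler0 addr0.
  have e2 : (c + b^-1%:C *: (J * star w)) * (b%:C *: (w * (1 - z) * n)) = n.
    rewrite scalAr mulrDl scalAl -!mulrA (mulrA c) -cf -(mulrA c) -n'w (mulrA f) fn'.
    rewrite mul0r mulr0 mul0r add0r scalrA divff ?gt_eqF // scale1r n'w.
    have e3 : n * ((1 - z) * n) = (1 - z) * n.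
      by rewrite (mulrBl n) mul1r zn1 (mulrBr n) nn nz1.
    by rewrite (mulrA (star w)) ww e3 (mulrA J) J2 mul1r.
  by rewrite e1 e2.
(* From p h = p follows p n = p n (h n), and |h n| <= 1/4 forces p n = 0. *)
- move=> p pp px xp; have [sp _] := pp.
  have pxs : p * star x = p by rewrite -[in LHS]sp -star_mul xp.
  have ph : p * h = p by rewrite /h mulrA pxs.
  have pn0 : p * n = 0.
    apply: nr_eq0; have e : p * n = p * n * (h * n).
      by rewrite hn mulrA -(mulrA p) nn -mulrA -hn mulrA ph.
    have := nrM (p * n) (h * n); rewrite -e; have := nr_ge0 (p * n).
    by move: nhn; set q := nr (h * n); set q' := nr _; rnra.
  have np0 : n * p = 0 by apply: proj_orthC.
  have pn'0 : p * n' = 0.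
    by apply: proj_orthC => //; rewrite -xp mulrA n'x -mulrA np0 mulr0.
  by split; [rewrite -wn -mulrA np0 mulr0 | rewrite -n'w mulrA pn'0 mul0r].
Qed.

(* [e + k] is the idempotent onto [e] along a slightly tilted complement, and
   [x] is its restriction to [f], an isomorphism with inverse [y]. *)
Lemma inverse_of_difference (t e f x y k b : A) : projection e -> projection f ->
  f * t = t * e -> b * t = 1 - e -> t * b = 1 - f -> (1 - e) * b = b ->
  b * (1 - f) = b -> e * k = k -> k * e = 0 ->
  (e + k) * f = x -> x * y = e -> y * x = f -> f * y = y -> y * e = y ->
  nr x <= 21 / 20 -> nr (t * e) <= 2^-1 -> nr k <= 20^-1 -> nr b ^+ 2 <= 8 ->
  is_idempotent (y * (e + k)) /\
  exists s, is_inverse (t - y * (e + k)) s /\ nr s <= 4.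
Proof.
move=> [se ee] [sf ff] ft bt tb eb bf ek ke ekf xy yx fy ye nx nt nk nb.
have ex : e * x = x by rewrite -ekf mulrA mulrDr ee ek.
have xf : x * f = x by rewrite -ekf -mulrA ff.
have eky : (e + k) * y = e by rewrite -fy mulrA ekf.
have eb0 : e * b = 0 by rewrite -eb mulrA mulrBr mulr1 ee subrr mul0r.
have bf0 : b * f = 0 by rewrite -bf -mulrA mulrBl mul1r ff subrr mulr0.
have by0 : b * y = 0 by rewrite -fy mulrA bf0 mul0r.
split.
  by rewrite /is_idempotent mulrA -(mulrA y) eky ye.
(* Followed by [x], the block of the difference from [e] to [f] becomes z - e, which is invertible
   in the corner of [e] with inverse [- r]. *)
set z := x * (t * e).
have ez : e * z = z by rewrite /z mulrA ex.
have ze : z * e = z by rewrite /z -!mulrA ee.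
have nz : nr z <= 21 / 40.
  by apply: le_trans (nrM_le nx nt) _; lra.
have z1 : nr z < 1 by apply: le_lt_trans nz _; lra.
have [J [J1 J2 nJ Jc]] := neumann z1.
have eJ : e * J = J * e by apply: Jc; rewrite ez ze.
set r := J * e.
have er : e * r = r by rewrite /r mulrA eJ -mulrA ee.
have re : r * e = r by rewrite /r -mulrA ee.
have rz : r * z = r - e.
  have : r * (1 - z) = e.
    by rewrite /r -eJ -mulrA J2 mulr1.
  by rewrite mulrBr mulr1 => <-; ncring.
have zr : z * r = r - e.
  have : (1 - z) * r = e by rewrite /r mulrA J1 mul1r.
  by rewrite mulrBl mul1r => <-; ncring.
have xt : x * t = z by rewrite /z -ft mulrA xf.
have kr : k * r = 0 by rewrite -er mulrA ke mul0r.
have te : t * e = y * z by rewrite /z mulrA yx mulrA ft -mulrA ee.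
have tr : t * r = y * (r - e) by rewrite -[in LHS]er mulrA te -mulrA zr.
have nJ' : nr J <= 40 / 19.
  apply: le_trans nJ _; rewrite -[leRHS]invrK lef_pV2 ?posrE ?invf_div; lra.
have nR : nr r <= 40 / 19.
  by rewrite -[leRHS]mulr1; apply: nrM_le => //; exact: nr_proj.
clearbody r.
(* The inverse of a triangular block matrix: [- r x] and [b] invert the diagonal blocks, the other
   block is [- y k], and x y = e turns the mixed term into [- r k b]. *)
exists (b - r * x - r * k * b); split; first split.
- have e1 : t * (b - r * x - r * k * b) = (1 - f) - y * (r - e) * x - y * (r - e) * k * b.
    by rewrite (mulrBr t) (mulrBr t) tb -(mulrA r k) (mulrA t r x) (mulrA t r (k * b)) tr (mulrA _ k b).
  have e2 : (e + k) * (b - r * x - r * k * b) = k * b - r * x - r * k * b.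
    rewrite mulrDl !(mulrBr e) !(mulrBr k) eb0 -(mulrA r k) (mulrA e r x) (mulrA e r (k * b)) (mulrA k r x) (mulrA k r (k * b)) er kr.
    by rewrite !mul0r; ncring.
  have h1 : y * (r - e) * x = y * r * x - f by rewrite (mulrBr y) mulrBl ye yx.
  have h2 : y * (r - e) * k * b = y * r * k * b - y * k * b.
    by rewrite (mulrBr y) mulrBl mulrBl ye.
  rewrite (mulrBl _ t) e1 -(mulrA y (e + k)) e2 h1 h2; ncring.
- have e1 : (b - r * x - r * k * b) * t = (1 - e) - (r - e) - r * k.
    rewrite (mulrBl t) (mulrBl t) bt -(mulrA r x) xt rz -(mulrA _ b) bt.
    by rewrite (mulrBr (r * k)) mulr1 -(mulrA r) ke mulr0 subr0.
  have e2 : (b - r * x - r * k * b) * y = - r.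
    by rewrite (mulrBl y) (mulrBl y) by0 -(mulrA r x) xy re -(mulrA _ b) by0 mulr0; ncring.
  rewrite (mulrBr _ t) e1 (mulrA _ y (e + k)) e2 mulNr (mulrDr r) re; ncring.
have n1 : nr (r * x) <= 40 / 19 * (21 / 20) by apply: nrM_le.
have nb' : nr b <= 3.
  rewrite -(ler_pXn2r (ltn0Sn 1)) ?nnegrE ?nr_ge0 //; apply: le_trans nb _; lra.
have n2 : nr (r * k * b) <= 40 / 19 * 20^-1 * 3 by do 2 apply: nrM_le => //.
(* Since b f = 0 and x f = x, the mixed terms vanish and the bounds on squared norms add; the plain
   triangle inequality would exceed 4. *)
have n3 : nr (b - r * x) ^+ 2 <= 8 + (40 / 19 * (21 / 20)) ^+ 2.
  rewrite -nr_starMr starB mulrBl !mulrBr.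
  have -> : b * star (r * x) = 0.
    by rewrite star_mul -xf star_mul sf -mulrA (mulrA b) bf0 mul0r.
  have -> : r * x * star b = 0.
    by apply: star_inj; rewrite star_mul starK -xf !star_mul sf -!mulrA mulrA bf0 mul0r star0.
  rewrite subr0 sub0r opprK; apply: le_trans (nrD _ _) _; rewrite !nr_starMr.
  by apply: lerD => //; rewrite ler_pXn2r ?nnegrE ?nr_ge0 //; lra.
have n4 : nr (b - r * x) <= 73 / 20.
  rewrite -(ler_pXn2r (ltn0Sn 1)) ?nnegrE ?nr_ge0 ?divr_ge0 //.
  by apply: le_trans n3 _; lra.
apply: le_trans (nrB _ _) _; move: n2 n4.
set q := nr (b - r * x); set q' := nr _; rlra.
Qed.

(** With [v] a partial isometry from [e] to [f], the compression d = e v may fail to be invertible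
    in the corner of [e]. The tilt [k] is chosen so that k v is exactly the term that
    [invertible_perturbation] adds to d; then e + k maps [f] isomorphically onto [e]. *)
Lemma finite_clean (t : A) : AWstar A -> finite_projection (1 : A) ->
  exists p : A, is_idempotent p /\ exists s, is_inverse (t - p) s /\ nr s <= 4.
Proof.
move=> hA fin.
(* This cut gives |t e| <= 1/2 and |c|^2 <= 8. *)
have m0 : 0 < (8^-1 : R) by rewrite invr_gt0.
have [g [h [u [c [[pg ph uu uu'] [[ct tc gc ch] [nc nt]]]]]]] := polar_cut t hA m0.
set e := 1 - g; set f := 1 - h.
have pe : projection e := projectionC pg.
have pf : projection f := projectionC ph.
have e1 : 1 - e = g by rewrite /e; ncring.
have f1 : 1 - f = h by rewrite /f; ncring.
have [v [pv vv vv']] : proj_equiv e f.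
  apply: finite_cancellation => //; rewrite e1 f1.
  by exists u; split=> //; rewrite /partial_isometry uu.
have [se ee] := pe; have [sf ff] := pf; have [sg gg] := pg.
have ve : v * e = v by rewrite -vv pi_source.
have fv : f * v = v by rewrite -vv' pi_final_id.
have vsf : star v * f = star v by rewrite -[in RHS]fv star_mul sf.
have evs : e * star v = star v by rewrite -[in RHS]ve star_mul se.
have eg : e * g = 0 by rewrite /e mulrBl mul1r gg subrr.
have ge : g * e = 0 by rewrite /e mulrBr mulr1 gg subrr.
pose d := e * v.
have de : d * e = d by rewrite /d -mulrA ve.
have ed : e * d = d by rewrite /d mulrA ee.
(* Adding [g] moves the problem from the corner of [e] to the whole algebra; as [x] is the identity
   on [g], the perturbing [w] vanishes there. *)
pose x := d + g.
have sxx : 1 - star x * x = e - star d * d.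
  have dg : d * g = 0 by rewrite -de -mulrA eg mulr0.
  have gd : g * d = 0 by rewrite -ed mulrA ge mul0r.
  have sdg : star d * g = 0 by rewrite -ed star_mul se -mulrA eg mulr0.
  by rewrite /x starD sg mulrDl !mulrDr sdg gd gg /e; ncring.
have b01 : 0 < (20^-1 : R) <= 1 by lra.
have [w [i [pw [yi iy] wp]]] := invertible_perturbation x hA fin b01.
have [wg gw] : w * g = 0 /\ g * w = 0.
  apply: wp => //; rewrite /x ?mulrDr ?mulrDl gg.
    by rewrite -ed mulrA ge mul0r add0r.
  by rewrite -de -mulrA eg mulr0 add0r.
have we : w * e = w by rewrite /e mulrBr mulr1 wg subr0.
have ew : e * w = w by rewrite /e mulrBl mul1r gw subr0.
set y0 := x + _ in yi iy; rewrite sxx in y0 yi iy.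
set k := 20^-1%:C *: (w * star v * g).
set q := d + 20^-1%:C *: (w * (e - star d * d)).
have y0E : y0 = q + g by rewrite /y0 /x /q; ncring.
have eq : e * q = q by rewrite /q mulrDr ed scalAr mulrA ew.
have qe : q * e = q.
  by rewrite /q mulrDl de scalAl -mulrA mulrBl ee -(mulrA (star d)) de.
have qi : q * i = e.
  by rewrite -[RHS]mulr1 -yi y0E mulrA mulrDr eq eg addr0.
have iq : i * q = e.
  by rewrite -[RHS]mul1r -iy y0E -mulrA mulrDl qe ge addr0.
(* This holds because v^* g v = v^* v - v^* e v = e - d^* d. *)
have kv : k * v = 20^-1%:C *: (w * (e - star d * d)).
  rewrite /k scalAl -(mulrA w) -(mulrA w); congr (_ *: (w * _)).
  by rewrite -e1 mulrBr mulr1 mulrBl vv /d star_mul se -!mulrA (mulrA e e) ee.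
have ek : e * k = k by rewrite /k scalAr !mulrA ew.
have ke : k * e = 0 by rewrite /k scalAl -mulrA ge mulr0 scaler0.
have nk : nr k <= 20^-1.
  rewrite /k nrZr ger0_norm // ler_piMr // -(mulr1 1); apply: nrM_le; last exact: nr_proj.
  rewrite -(mulr1 1); apply: nrM_le; first exact: nr_piso.
  by rewrite nr_star; exact: nr_piso.
have ekf : (e + k) * f = q * star v.
  by rewrite -vv' mulrA mulrDl kv -/d.
have nx : nr (q * star v) <= 21 / 20.
  rewrite -ekf -[leRHS]mulr1; apply: nrM_le; last exact: nr_proj.
  by apply: le_trans (nrD _ _) _; have := nr_proj pe; move: nk; rlra.
have nte : nr (t * e) <= 2^-1.
  rewrite -(ler_pXn2r (ltn0Sn 1)) ?nnegrE ?nr_ge0 ?invr_ge0 //.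
  by apply: le_trans nt _; lra.
have ft : f * t = t * e.
  by rewrite /f /e mulrBl mulrBr mul1r mulr1 -tc -ct mulrA.
have xy : q * star v * (v * i * e) = e.
  by rewrite !mulrA -(mulrA q) vv qe qi ee.
have yx : v * i * e * (q * star v) = f.
  by rewrite !mulrA -(mulrA (v * i)) eq -(mulrA v) iq ve.
have ct' : c * t = 1 - e by rewrite e1.
have tc' : t * c = 1 - f by rewrite f1.
have ec : (1 - e) * c = c by rewrite e1.
have cf : c * (1 - f) = c by rewrite f1.
have fy : f * (v * i * e) = v * i * e by rewrite !mulrA fv.
have ye : v * i * e * e = v * i * e by rewrite -mulrA ee.
have nc8 : nr c ^+ 2 <= 8 by apply: le_trans nc _; rewrite invrK.
have [pP [s [sP sn]]] :=
  inverse_of_difference pe pf ft ct' tc' ec cf ek ke ekf xy yx fy ye nx nte nk nc8.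
by exists (v * i * e * (e + k)); split=> //; exists s.
Qed.

End CStar.

Theorem theorem4p2 (R : realType) (A : cstarAlgType R) (hA : finite_AWstar A) :
  clean_ring A /\
  (forall T : A, exists P : A, is_idempotent P /\
     exists S : A, is_inverse (T - P) S /\ `|S| <= 4).
Proof.
have clean (T : A) := finite_clean T hA.1 hA.2.
split=> T; have [P [PP [S [TPS S4]]]] := clean T.
  by exists (T - P), P; split=> //; [exists S | rewrite subrK].
exists P; split=> //; exists S; split=> //.
by rewrite normE -(rmorph_nat (real_complex R) 4) lecR.
Qed.
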